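(* Let $n\ge 1$ be an integer, $p>0$ and $0<q\le 1+\frac{2n}{p}$. Let $u$ be a non-negative Lebesgue measurable function in $\mathbb{R}^n$ satisfying $$u(x)=\int_{\mathbb{R}^n}|x-y|^p\,u(y)^{-q}\,dy\qquad\text{for all }x\in\mathbb{R}^n.$$ Then $q=1+\frac{2n}{p}$ and, for some constants $a,d>0$ and some $\bar x\in\mathbb{R}^n$, $$u(x)=\left(\frac{d+|x-\bar x|^2}{a}\right)^{\frac p2}\qquad\text{for all }x\in\mathbb{R}^n.$$
   Context: The function $u$ is defined at every point of $\mathbb{R}^n$ with values a priori in $[0,\infty]$, with the conventions $0^{-q}=\infty$ and $\infty^{-q}=0$; the equation holds pointwise everywhere. *)

(* Defs.v *)
From HB Require Import structures.
From mathcomp Require Import all_boot all_order all_algebra.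
From mathcomp Require Import all_classical all_reals all_analysis.
From mathcomp Require Import measurable_realfun.
Set Implicit Arguments.
Unset Strict Implicit.
Unset Printing Implicit Defensive.
Import Order.TTheory GRing.Theory Num.Theory.
Import numFieldNormedType.Exports.
Local Open Scope classical_set_scope.
Local Open Scope ring_scope.

(* The library norm `|x| on 'rV[R]_n is the sup norm, hence this definition. *)
Definition enorm (R : realType) (n : nat) (x : 'rV[R]_n) : R :=
  Num.sqrt (\sum_(i < n) x ord0 i ^+ 2).

Definition rV_coord (R : realType) (n : nat) (i : 'I_n) (x : 'rV[R]_n) :
  measurableTypeR R := x ord0 i.

(* Borel sigma-algebra of R^n: generated by the coordinate functions, exactly
   as the library does for n.-tuple T. *)
Definition rV_display (R : realType) : measure_display.
Proof. exact. Qed.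

Section borel_rV.
Variables (R : realType) (n : nat).
Let G : set (set 'rV[R]_n) := g_sigma_preimage (@rV_coord R n).

Let rV_set0 : G set0.
Proof. exact: sigma_algebra0. Qed.

Let rV_setC A : G A -> G (~` A).
Proof. exact: sigma_algebraC. Qed.

Let rV_bigcup (F : (set 'rV[R]_n)^nat) :
  (forall i, G (F i)) -> G (\bigcup_i (F i)).
Proof. exact: sigma_algebra_bigcup. Qed.

HB.instance Definition _ := @isMeasurable.Build (rV_display R)
  'rV[R]_n G rV_set0 rV_setC rV_bigcup.

End borel_rV.

Lemma measurable_rV_coord (R : realType) (n : nat) (i : 'I_n) :
  measurable_fun [set: 'rV[R]_n] (@rV_coord R n i).
Proof.
move=> _ Y mY; rewrite setTI; apply: sub_sigma_algebra => /=.
rewrite -bigcup_seq/=; exists i => /=; first by rewrite mem_index_enum.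
by exists Y => //; rewrite setTI.
Qed.

Lemma measurable_fun_rVP (R : realType) d (T : measurableType d) (n : nat)
    (f : T -> 'rV[R]_n) :
  (forall i, measurable_fun setT (@rV_coord R n i \o f)) ->
  measurable_fun setT f.
Proof.
move=> mf _ A mA; rewrite setTI.
suff: measurable `<=` [set B : set 'rV[R]_n | measurable (f @^-1` B)] by exact.
apply: smallest_sub.
  split => /=.
  - by rewrite preimage_set0.
  - by move=> B mB; rewrite setTD preimage_setC; exact: measurableC.
  - move=> F mF; rewrite preimage_bigcup; exact: bigcup_measurable.
rewrite -bigcup_seq/=; apply: bigcup_sub => i _ B [C mC <-] /=.
by rewrite setTI -comp_preimage -[X in measurable X]setTI; exact: mf.
Qed.

Definition rV_cons (R : realType) (n : nat)
  (z : measurableTypeR R * 'rV[R]_n) : 'rV[R]_n.+1 :=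
  \row_(i < n.+1) oapp (fun j : 'I_n => z.2 ord0 j) z.1 (unlift ord0 i).

Lemma measurable_rV_cons (R : realType) (n : nat) :
  measurable_fun setT (@rV_cons R n).
Proof.
apply: measurable_fun_rVP => i.
have [->|[j ->]] : i = ord0 \/ exists j, i = lift ord0 j.
  by case: (unliftP ord0 i) => [j ->|->]; [right; exists j|left].
- rewrite (_ : _ \o _ = fst); first exact: measurable_fst.
  by apply/funext => z /=; rewrite /rV_coord mxE unlift_none.
- rewrite (_ : _ \o _ = @rV_coord R n j \o snd).
    by apply: measurableT_comp; [exact: measurable_rV_coord|exact: measurable_snd].
  by apply/funext => z /=; rewrite /rV_coord mxE liftK.
Qed.


(* n-fold product of the Lebesgue measure of the line, transported to R^n along
   rV_cons; R^0 is one point, of mass 1. *)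
Fixpoint lebesgue_rV_borel (R : realType) (n : nat) : set 'rV[R]_n -> \bar R :=
  if n is n'.+1 then
    pushforward (@lebesgue_measure R \x @lebesgue_rV_borel R n')%E (@rV_cons R n')
  else \d_(0 : 'rV[R]_0).

Arguments lebesgue_rV_borel : clear implicits.

Section lebesgue_rV_borel_measure.
Variable R : realType.

Let ex_sigma_finite_measure d (T : measurableType d) (S : set T -> \bar R) :
  S set0 = 0%E -> (forall A, (0 <= S A)%E) -> semi_sigma_additive S ->
  sigma_finite setT S ->
  exists m : {sigma_finite_measure set T -> \bar R}, S = m.
Proof.
move=> s0 sge0 sadd sfin.
pose mS := isMeasure.Build _ _ _ S s0 sge0 sadd.
pose S1 : {measure set T -> \bar R} := HB.pack S mS.
pose sS := Measure_isSigmaFinite.Build _ _ _ S1 sfin.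
pose S2 : {sigma_finite_measure set T -> \bar R} := HB.pack S mS sS.
by exists S2.
Qed.

Local Notation mu := (lebesgue_rV_borel R).

Let mu_measure n :
  exists m : {sigma_finite_measure set 'rV[R]_n -> \bar R}, mu n = m.
Proof.
elim: n => [|n [m mE]].
  by exists (\d_(0 : 'rV[R]_0)).
have mf := @measurable_rV_cons R n.
pose P : {measure set (measurableTypeR R * 'rV[R]_n)%type -> \bar R} :=
  (@lebesgue_measure R \x m)%E.
have sP : sigma_finite setT P.
  have /sigma_finiteP[F [TF ndF Foo]] := sigma_finiteT (@lebesgue_measure R).
  have /sigma_finiteP[G [TG ndG Goo]] := sigma_finiteT m.
  exists (fun k => F k `*` G k).
    rewrite -setXTT TF TG predeqE => -[x y]; split.
      move=> [/= [k _ Fx] [l _ Gy]]; exists (maxn k l) => //; split.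
      - by move: x Fx; exact/subsetPset/ndF/leq_maxl.
      - by move: y Gy; exact/subsetPset/ndG/leq_maxr.
    by move=> [k _ []/= ? ?]; split; exists k.
  move=> k; have [mF Fk] := Foo k; have [mG Gk] := Goo k.
  split; first exact: measurableX.
  by rewrite /P /= product_measure1E// lte_mul_pinfty// ge0_fin_numE.
have mP A : measurable A -> measurable (@rV_cons R n @^-1` A).
  by move=> mA; rewrite -[X in measurable X]setTI; exact: mf.
have s0 : pushforward P (@rV_cons R n) set0 = 0%E.
  by rewrite /pushforward preimage_set0 measure0.
have sge0 A : (0 <= pushforward P (@rV_cons R n) A)%E by exact: measure_ge0.
have sadd : semi_sigma_additive (pushforward P (@rV_cons R n)).
  move=> F mF tF mUF; rewrite /pushforward preimage_bigcup.
  apply: measure_semi_sigma_additive.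
  - by move=> k; exact: mP.
  - apply/trivIsetP => /= i j _ _ ij; rewrite -preimage_setI.
    by move/trivIsetP : tF => /(_ _ _ _ _ ij) ->//; rewrite preimage_set0.
  - by rewrite -preimage_bigcup; exact: mP.
have sfin : sigma_finite setT (pushforward P (@rV_cons R n)).
  have [F TF Foo] := sP.
  pose g (v : 'rV[R]_n.+1) : measurableTypeR R * 'rV[R]_n :=
    (v ord0 ord0, \row_j v ord0 (lift ord0 j)).
  have gK : cancel g (@rV_cons R n).
    move=> v; apply/rowP => i; rewrite mxE.
    by case: unliftP => [j ->|->] /=; rewrite ?mxE.
  have cK : cancel (@rV_cons R n) g.
    move=> [t v]; rewrite /g; congr pair; first by rewrite mxE unlift_none.
    by apply/rowP => j; rewrite !mxE liftK.
  have mg : measurable_fun setT g.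
    apply/measurable_fun_pairP; split.
      exact: (@measurable_rV_coord R n.+1 ord0).
    apply: measurable_fun_rVP => i.
    rewrite (_ : _ \o _ = @rV_coord R n.+1 (lift ord0 i)).
      exact: measurable_rV_coord.
    by apply/funext => v; rewrite /= /rV_coord mxE.
  exists (fun k => g @^-1` F k).
    by rewrite -preimage_bigcup -TF preimage_setT.
  move=> k; have [mFk Fk] := Foo k; split.
    by rewrite -[X in measurable X]setTI; exact: mg.
  rewrite /pushforward -comp_preimage (_ : _ \o _ = id)//.
  by apply/funext => z; exact: cK.
have [S SE] := ex_sigma_finite_measure s0 sge0 sadd sfin.
by exists S; rewrite /= mE -SE.
Qed.

Variable n : nat.

Let mu0 : mu n set0 = 0%E.
Proof. by have [m ->] := mu_measure n; exact: measure0. Qed.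

Let mu_ge0 A : (0 <= mu n A)%E.
Proof. by have [m ->] := mu_measure n; exact: measure_ge0. Qed.

Let mu_sigma_additive : semi_sigma_additive (mu n).
Proof.
by have [m ->] := mu_measure n; exact: measure_semi_sigma_additive.
Qed.

Let mu_sigma_finite : sigma_finite setT (mu n).
Proof. by have [m ->] := mu_measure n; exact: sigma_finiteT. Qed.

HB.instance Definition _ := isMeasure.Build _ _ _ (mu n)
  mu0 mu_ge0 mu_sigma_additive.
HB.instance Definition _ := Measure_isSigmaFinite.Build _ _ _ (mu n)
  mu_sigma_finite.

End lebesgue_rV_borel_measure.

Lemma lebesgue_rV_borel_box (R : realType) (n : nat)
    (A : 'I_n -> set (measurableTypeR R)) :
  (forall i, measurable (A i)) ->
  lebesgue_rV_borel R n [set x | forall i, A i (x ord0 i)] =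
  (\prod_(i < n) lebesgue_measure (A i))%E.
Proof.
elim: n A => [|n IH] A mA.
  rewrite big_ord0 /= diracE mem_set//; by move=> [].
rewrite big_ord_recl /= /pushforward -IH; last by move=> i; exact: mA.
rewrite -product_measure1E; [|exact: mA|].
- congr (product_measure1 _ _ _); apply/seteqP; split => [[t v] /= Av|[t v] /= [At Av] i].
  + split; first by have := Av ord0; rewrite mxE unlift_none.
    by move=> i; have := Av (lift ord0 i); rewrite mxE liftK.
  + by rewrite mxE; case: unliftP => [j ->|->].
- rewrite [X in measurable X](_ : _ =
    \bigcap_(i in [set: 'I_n]) (@rV_coord R n i @^-1` A (lift ord0 i))).
    apply: fin_bigcap_measurable => // i _.
    by rewrite -[X in measurable X]setTI; exact: measurable_rV_coord.
  by apply/seteqP; split => [v /= Av i _|v /= Av i]; exact: Av.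
Qed.

(* The alias lebesgue_rV_type R n of 'rV[R]_n carries the sigma-algebra of
   Lebesgue measurable sets (Caratheodory), 'rV[R]_n itself the Borel one. *)
Definition lebesgue_rV_type (R : realType) (n : nat) :
    measurableType (lebesgue_rV_borel R n)^*%mu.-cara :=
  caratheodory_type ((lebesgue_rV_borel R n)^*)%mu.

Definition lebesgue_rV (R : realType) (n : nat) :
    set (lebesgue_rV_type R n) -> \bar R :=
  @completed_measure_extension _ _ _ (lebesgue_rV_borel R n).
Arguments lebesgue_rV : clear implicits.

HB.instance Definition _ (R : realType) (n : nat) :=
  Measure.on (lebesgue_rV R n).

Lemma lebesgue_rV_sigma_finite (R : realType) (n : nat) :
  sigma_finite [set: lebesgue_rV_type R n] (lebesgue_rV R n).
Proof.
exact: (completed_measure_extension_sigma_finite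
  (sigma_finiteT (lebesgue_rV_borel R n))).
Qed.

HB.instance Definition _ (R : realType) (n : nat) :=
  Measure_isSigmaFinite.Build _ _ _ (lebesgue_rV R n)
    (@lebesgue_rV_sigma_finite R n).

Lemma lebesgue_rV_complete (R : realType) (n : nat) :
  measure_is_complete (lebesgue_rV R n).
Proof. exact: measure_is_complete_caratheodory. Qed.

Lemma lebesgue_rV_borelE (R : realType) (n : nat) (A : set 'rV[R]_n) :
  measurable A -> lebesgue_rV R n A = lebesgue_rV_borel R n A.
Proof. by move=> mA; exact: measurable_mu_extE. Qed.

(* For x >= 0 and q > 0 this is x^{-q} with 0^{-q} = +oo and (+oo)^{-q} = 0.
   The library's x `^ (- q) has the value 0 at 0 and +oo at +oo instead. *)
Definition poweRV (R : realType) (x : \bar R) (q : R) : \bar R :=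
  ((x `^ q)^-1)%E.

Lemma poweRV0 (R : realType) (q : R) : 0 < q -> poweRV 0%E q = +oo%E.
Proof. by move=> q0; rewrite /poweRV poweR0r ?gt_eqF// inve0. Qed.

Lemma poweRVy (R : realType) (q : R) : 0 < q -> poweRV +oo%E q = 0%E.
Proof. by move=> q0; rewrite /poweRV poweRyr ?gt_eqF// invey. Qed.

Lemma poweRV_fin (R : realType) (r q : R) :
  0 < r -> poweRV r%:E q = (r `^ (- q))%:E.
Proof.
by move=> r0; rewrite /poweRV poweR_EFin powRN inver gt_eqF// powR_gt0.
Qed.

(* Main.v *)
(** The function u is finite, positive, Borel and continuous on lines, and grows
    like |x|^p.  The method of moving spheres is applied to the integral equation
    itself: with x^* the inversion of x in the sphere of radius l around a point
    and u_l(x) = (|x|/l)^p u(x^* ), folding the integral onto |z| > l gives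
      u_l(x) - u(x) = int_{|z| > l} (b - a)(f - g),   b > a > 0,   f = u^-q,
      g = (l/|z|)^(2n+p-pq) u_l^-q,
    which yields both a strong maximum principle (u_l >= u implies u_l > u
    throughout, or u_l = u and 2n + p = pq) and a narrow region principle (the set
    where u_l < u is empty as soon as a weighted measure of it is small).  As the
    admissible radii are nonempty and bounded, the supremum is critical, so u = u_l
    for some l at every centre.  Then v = (u / int u^-q)^(2/p) is the square of the
    critical radius, and letting one of the two points in
      v(x) v(y) = |y-x|^2 v(x + v(x) (y-x) / |y-x|^2)
    go to infinity along a line forces v - |x|^2 to be affine there. *)

Require Import Defs.
From HB Require Import structures.
From mathcomp Require Import all_boot all_order all_algebra.
From mathcomp Require Import all_classical all_reals all_analysis.
From mathcomp Require Import measurable_realfun ring lra.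
Set Implicit Arguments.
Unset Strict Implicit.
Unset Printing Implicit Defensive.
Import Order.TTheory GRing.Theory Num.Theory.
Import numFieldNormedType.Exports.
Local Open Scope classical_set_scope.
Local Open Scope ring_scope.

(** * Euclidean geometry and inversion *)

Section enorm.
Context {R : realType} {n : nat}.
Implicit Types (x y z : 'rV[R]_n) (t : R).

(** No Jacobian determinant is computed: |x|^-n dx is invariant under dilations, and averaging over
    dilations turns each ray into a line on which inversion is a reflection. Inverting both
    arguments of the kernel changes it only by factors depending on one argument each, so u and u_l
    are integrals of the same terms with the kernels a and b exchanged. The power of l/|z| left over
    is tau = 2n + p - pq, and q <= 1 + 2n/p says that tau >= 0: this factor helps the comparison u
    <= u_l, and tau > 0 would exclude equality, which is how the exponent is forced. Only continuity
    on lines is established, so no compactness argument is used. All convergence rests on the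
    integrability of (1+|y|)^p u^-q, a consequence of finiteness of u at two points: it dominates
    the integrals in the continuity proofs, yields the limit of |x|^-p u, and, through the resulting
    upper bound on u, controls the sets where u_l < u uniformly in the radius. Comparing the limits
    of |x|^-p u and |x|^-p u_l bounds the admissible radii and evaluates the critical one: l^p int
    u^-q = u(0). *)

Definition dotp x y : R := \sum_(i < n) x ord0 i * y ord0 i.

Lemma dotpC x y : dotp x y = dotp y x.
Proof. by apply: eq_bigr => i _; rewrite mulrC. Qed.

Lemma dotpDl x y z : dotp (x + y) z = dotp x z + dotp y z.
Proof. by rewrite -big_split; apply: eq_bigr => i _; rewrite mxE mulrDl. Qed.

Lemma dotpZl t x y : dotp (t *: x) y = t * dotp x y.
Proof. by rewrite mulr_sumr; apply: eq_bigr => i _; rewrite mxE mulrA. Qed.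

Lemma dotpDr x y z : dotp x (y + z) = dotp x y + dotp x z.
Proof. by rewrite !(dotpC x) dotpDl. Qed.

Lemma dotpZr t x y : dotp x (t *: y) = t * dotp x y.
Proof. by rewrite !(dotpC x) dotpZl. Qed.

Lemma dotpNl x y : dotp (- x) y = - dotp x y.
Proof. by rewrite -scaleN1r dotpZl mulN1r. Qed.

Lemma dotpNr x y : dotp x (- y) = - dotp x y.
Proof. by rewrite !(dotpC x) dotpNl. Qed.

Lemma dotp_ge0 x : 0 <= dotp x x.
Proof. by apply: sumr_ge0 => i _; rewrite -expr2 sqr_ge0. Qed.

Lemma enorm_dotp x : enorm x = Num.sqrt (dotp x x).
Proof. by rewrite /enorm; congr Num.sqrt; apply: eq_bigr => i _; rewrite expr2. Qed.

Lemma enorm_ge0 x : 0 <= enorm x. Proof. exact: sqrtr_ge0. Qed.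

Lemma sqr_enorm x : enorm x ^+ 2 = dotp x x.
Proof. by rewrite enorm_dotp sqr_sqrtr// dotp_ge0. Qed.

Lemma enormZ t x : enorm (t *: x) = `|t| * enorm x.
Proof.
by rewrite enorm_dotp dotpZl dotpZr mulrA -expr2 sqrtrM ?sqr_ge0// sqrtr_sqr -enorm_dotp.
Qed.

Lemma enormN x : enorm (- x) = enorm x.
Proof. by rewrite -scaleN1r enormZ normrN1 mul1r. Qed.

Lemma enorm_distC x y : enorm (x - y) = enorm (y - x).
Proof. by rewrite -enormN opprB. Qed.

Lemma enorm0 : enorm (0 : 'rV[R]_n) = 0.
Proof. by rewrite -(scale0r 0) enormZ normr0 mul0r. Qed.

Lemma coord_le_enorm x i : `|x ord0 i| <= enorm x.
Proof.
rewrite -sqrtr_sqr ler_sqrt ?sumr_ge0// => [|j _]; last exact: sqr_ge0.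
by rewrite (bigD1 i)//= lerDl sumr_ge0// => j _; exact: sqr_ge0.
Qed.

Lemma enorm_eq0 x : (enorm x == 0) = (x == 0).
Proof.
apply/eqP/eqP => [x0|->]; last exact: enorm0.
by apply/rowP => i; rewrite mxE; apply/eqP; rewrite -normr_le0 -x0 coord_le_enorm.
Qed.

Lemma enorm_gt0 x : (0 < enorm x) = (x != 0).
Proof. by rewrite lt_neqAle enorm_ge0 andbT eq_sym enorm_eq0. Qed.

Lemma cauchy_schwarz x y : dotp x y <= enorm x * enorm y.
Proof.
have [->|y0] := eqVneq y 0.
  by rewrite -(scale0r 0) dotpZr mul0r scale0r enorm0 mulr0.
have Y0 : 0 < dotp y y by rewrite -sqr_enorm exprn_gt0// enorm_gt0.
have := dotp_ge0 (x - (dotp x y / dotp y y) *: y).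
rewrite !(dotpDl, dotpDr, dotpNl, dotpNr, dotpZl, dotpZr) (dotpC y x) => H.
apply: le_trans (ler_norm _) _.
rewrite -(ler_pXn2r (n := 2))// ?nnegrE ?mulr_ge0 ?enorm_ge0//.
rewrite real_normK ?num_real// exprMn !sqr_enorm -ler_pdivrMr//.
by move: H; rewrite divfK ?gt_eqF// -subr_ge0 expr2; lra.
Qed.

Lemma enormD x y : enorm (x + y) <= enorm x + enorm y.
Proof.
rewrite -(ler_pXn2r (n := 2))// ?nnegrE ?addr_ge0 ?enorm_ge0//.
rewrite sqr_enorm dotpDl !dotpDr (dotpC y x) sqrrD !sqr_enorm.
have := cauchy_schwarz x y; lra.
Qed.

Lemma enormB x y : enorm (x - y) <= enorm x + enorm y.
Proof. by rewrite -(enormN y) enormD. Qed.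

Lemma measurable_enorm : measurable_fun setT (@enorm R n).
Proof.
apply: (@measurableT_comp _ _ _ _ _ _ (@Num.sqrt R)).
  by apply: continuous_measurable_fun; exact: sqrt_continuous.
apply: measurable_sum => i.
by apply: measurable_funX; exact: measurable_rV_coord.
Qed.

(** Inversion in the sphere of radius [t] about the origin. Division by zero sends the origin to
    itself, so [enorm_kelvin] holds there as well. *)
Definition kelvin t x : 'rV[R]_n := (t ^+ 2 / enorm x ^+ 2) *: x.

Lemma enorm_kelvin t x : enorm (kelvin t x) = t ^+ 2 / enorm x.
Proof.
rewrite enormZ ger0_norm; last by rewrite divr_ge0// sqr_ge0.
have [->|x0] := eqVneq (enorm x) 0; first by rewrite invr0 !mulr0.
by field.
Qed.

Lemma kelvin_neq0 t x : t != 0 -> x != 0 -> kelvin t x != 0.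
Proof.
by move=> t0 x0; rewrite -enorm_eq0 enorm_kelvin mulf_neq0 ?expf_neq0 ?invr_neq0 ?enorm_eq0.
Qed.

Lemma kelvinK t x : t != 0 -> x != 0 -> kelvin t (kelvin t x) = x.
Proof.
move=> t0 x0; rewrite {1}/kelvin enorm_kelvin scalerA -[RHS]scale1r; congr (_ *: _).
have : enorm x != 0 by rewrite enorm_eq0.
by move=> e0; field; rewrite e0 t0.
Qed.

(** The right-hand side is symmetric in [x] and [z]; this symmetry is [kelvin_dist], the conformal
    behaviour of distances under inversion. *)
Lemma kelvin_dist2 t x z : x != 0 -> z != 0 ->
  (enorm z * enorm (x - kelvin t z)) ^+ 2 =
  enorm z ^+ 2 * enorm x ^+ 2 - 2 * t ^+ 2 * dotp x z + t ^+ 4.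
Proof.
move=> x0 z0; rewrite exprMn !sqr_enorm.
rewrite !(dotpDl, dotpDr, dotpNl, dotpNr, dotpZl, dotpZr) (dotpC z x) !sqr_enorm.
have : dotp z z != 0 by rewrite -sqr_enorm sqrf_eq0 enorm_eq0.
by move=> ?; field.
Qed.

Lemma kelvin_dist t x z : x != 0 -> z != 0 ->
  enorm z * enorm (x - kelvin t z) = enorm x * enorm (kelvin t x - z).
Proof.
move=> x0 z0; apply/eqP.
rewrite -(eqrXn2 (n := 2))// ?mulr_ge0 ?enorm_ge0//; apply/eqP.
by rewrite kelvin_dist2// enorm_distC kelvin_dist2// dotpC; ring.
Qed.

(** After squaring, the difference of the two sides factors as (|x|^2 - t^2)(|z|^2 - t^2). This is
    the source of the strict inequality between the kernel and its reflection. *)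
Lemma kelvin_dist_lt t x z : 0 < t -> t < enorm x -> t < enorm z ->
  t * enorm (x - z) < enorm x * enorm (kelvin t x - z).
Proof.
move=> t0 tx tz.
have x0 : x != 0 by rewrite -enorm_gt0 (lt_trans t0).
have z0 : z != 0 by rewrite -enorm_gt0 (lt_trans t0).
rewrite -(ltr_pXn2r (n := 2))// ?nnegrE ?mulr_ge0 ?enorm_ge0// ?(ltW t0)//.
rewrite enorm_distC (enorm_distC (kelvin _ _)) kelvin_dist2//.
rewrite exprMn (sqr_enorm (z - x)) !(dotpDl, dotpDr, dotpNl, dotpNr) -!sqr_enorm.
rewrite -subr_gt0 [X in 0 < X](_ : _ =
  (enorm x ^+ 2 - t ^+ 2) * (enorm z ^+ 2 - t ^+ 2)); last by rewrite (dotpC x z); ring.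
by rewrite mulr_gt0// subr_gt0 ltr_pXn2r// nnegrE ?enorm_ge0// ltW.
Qed.

End enorm.

(** * Lebesgue measure under dilations, translations and inversions *)

Section lebesgue_measure_affine.
Local Open Scope ereal_scope.
Context {R : realType}.
Implicit Types (A : set (measurableTypeR R)) (f : measurableTypeR R -> \bar R).

Lemma measurable_affine (t b : R) :
  measurable_fun setT (fun s : measurableTypeR R => (t * s + b)%R : measurableTypeR R).
Proof. by apply: measurable_funD => //; exact: measurable_funM. Qed.

Lemma lebesgue_measure_affine (t b : R) A : (0 < t)%R -> measurable A ->
  t%:E * pushforward lebesgue_measure (fun s : measurableTypeR R => (t * s + b)%R : measurableTypeR R) A =
  lebesgue_measure A.
Proof.
move=> t0 mA.
pose phi (s : measurableTypeR R) : measurableTypeR R := (t * s + b)%R.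
suff: forall B, measurable B ->
    lebesgue_measure B = mscale (NngNum (ltW t0)) (pushforward lebesgue_measure phi) B.
  by move=> /(_ (measurable_affine t b) A mA) ->.
move=> mphi; apply: lebesgue_measure_unique => _ [[a c]] _ <-.
rewrite -[RHS]/(t%:E * lebesgue_measure (phi @^-1` `]a, c])).
rewrite [X in _ * lebesgue_measure X](_ : _ = `](a - b) / t, (c - b) / t]%classic)%R.
  rewrite !lebesgue_measure_itv/= !lte_fin ltr_pM2r ?invr_gt0// ltrBlDr subrK.
  case: ifPn => _; last by rewrite mule0.
  rewrite -!EFinB -EFinM; congr EFin; field; exact: lt0r_neq0.
by apply/seteqP; split => s /=; rewrite !in_itv/= ltr_pdivrMr// ler_pdivlMr// ltrBlDr lerBrDr mulrC.
Qed.

Lemma ge0_integral_affine (t : R) (b : R) f : (0 < t)%R ->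
  measurable_fun setT f -> (forall s, 0 <= f s) ->
  t%:E * \int[lebesgue_measure]_s f (t * s + b)%R = \int[lebesgue_measure]_s f s.
Proof.
move=> t0 mf f0.
pose phi (s : measurableTypeR R) : measurableTypeR R := (t * s + b)%R.
have E : \int[lebesgue_measure]_s f s =
    \int[mscale (NngNum (ltW t0)) (pushforward lebesgue_measure phi)]_s f s.
  by move=> mphi; apply: eq_measure_integral => A mA _; apply/esym; exact: lebesgue_measure_affine.
rewrite (E (measurable_affine t b)) ge0_integral_mscale// ge0_integral_pushforward//.
exact: measurable_affine.
Qed.

Lemma ge0_integral_reflect (b : R) f :
  measurable_fun setT f -> (forall s, 0 <= f s) ->
  \int[lebesgue_measure]_s f (b - s)%R = \int[lebesgue_measure]_s f s.
Proof.
move=> mf f0.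
rewrite -[RHS](@ge0_integral_affine 1%R b)// mul1e.
have mfb : measurable_fun setT (fun s : measurableTypeR R => f (1 * s + b)%R).
  by apply: measurableT_comp => //; exact: measurable_affine.
transitivity (\int[pushforward lebesgue_measure (-%R : _ -> measurableTypeR R)]_s f (1 * s + b)%R).
  rewrite ge0_integral_pushforward//=.
  by apply: eq_integral => s _ /=; rewrite mul1r addrC.
by apply: eq_measure_integral => A mA _; exact: lebesgue_measureN.
Qed.

End lebesgue_measure_affine.

Section lebesgue_rV_borel_affine.
Local Open Scope ereal_scope.
Context {R : realType}.
Local Notation mu := (lebesgue_rV_borel R).

Lemma ge0_integral_rV_cons n (f : 'rV[R]_n.+1 -> \bar R) :
  measurable_fun setT f -> (forall x, 0 <= f x) ->
  \int[mu n.+1]_x f x = \int[lebesgue_measure]_s \int[mu n]_v f (rV_cons (s, v)).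
Proof.
move=> mf f0; rewrite /= (ge0_integral_pushforward (@measurable_rV_cons R n))//.
have mfc : measurable_fun setT (f \o @rV_cons R n).
  by apply: measurableT_comp => //; exact: measurable_rV_cons.
by rewrite (fubini_tonelli1 _ mfc (fun z => f0 _)).
Qed.

Lemma measurable_integral_rV_cons n (f : 'rV[R]_n.+1 -> \bar R) :
  measurable_fun setT f -> (forall x, 0 <= f x) ->
  measurable_fun setT (fun s : measurableTypeR R => \int[mu n]_v f (rV_cons (s, v))).
Proof.
move=> mf f0.
have mfc : measurable_fun setT (f \o @rV_cons R n).
  by apply: measurableT_comp => //; exact: measurable_rV_cons.
exact: (measurable_fun_fubini_tonelli_F _ mfc (fun z => f0 _)).
Qed.

Lemma measurable_rV_affine n (t : R) (b : 'rV[R]_n) :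
  measurable_fun setT (fun x : 'rV[R]_n => t *: x + b)%R.
Proof.
apply: measurable_fun_rVP => i.
rewrite (_ : _ \o _ = (fun x => t * rV_coord i x + b ord0 i)%R).
  by apply: measurable_funD => //; apply: measurable_funM => //; exact: measurable_rV_coord.
by apply/funext => x; rewrite /= /rV_coord !mxE.
Qed.

Lemma ge0_integral_rV_affine n (t : R) (b : 'rV[R]_n) (f : 'rV[R]_n -> \bar R) :
  (0 < t)%R -> measurable_fun setT f -> (forall x, 0 <= f x) ->
  (t ^+ n)%:E * \int[mu n]_x f (t *: x + b)%R = \int[mu n]_x f x.
Proof.
move=> t0; elim: n b f => [|n IH] b f mf f0.
  rewrite expr0 mul1e; apply: eq_integral => x _; congr f.
  by apply/rowP; case.
have mfc s : measurable_fun setT (fun v => f (rV_cons (s, v))).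
  apply: measurableT_comp => //; apply: measurableT_comp; first exact: measurable_rV_cons.
  exact: measurable_pair1.
pose b' : 'rV[R]_n := \row_j b ord0 (lift ord0 j).
have E s v : (t *: rV_cons (s, v) + b)%R =
    rV_cons ((t * s + b ord0 ord0)%R : measurableTypeR R, (t *: v + b')%R).
  by apply/rowP => i; rewrite !mxE; case: unliftP => [j ->|->] /=; rewrite ?mxE.
have mfb : measurable_fun setT (fun x : 'rV[R]_n.+1 => f (t *: x + b)%R).
  by apply: measurableT_comp => //; exact: measurable_rV_affine.
rewrite !ge0_integral_rV_cons// exprS EFinM -muleA.
rewrite -[RHS](@ge0_integral_affine _ t (b ord0 ord0))//; last 2 first.
- exact: (measurable_integral_rV_cons mf f0).
- by move=> s; exact: integral_ge0.
congr (_ * _); rewrite -ge0_integralZl//.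
- apply: eq_integral => s _; under eq_integral do rewrite E.
  by rewrite -(IH b' (fun v => f (rV_cons ((t * s + b ord0 ord0)%R : measurableTypeR R, v)))).
- exact: (measurable_integral_rV_cons mfb (fun x => f0 _)).
- by move=> s _; exact: integral_ge0.
- by rewrite lee_fin exprn_ge0// ltW.
Qed.

End lebesgue_rV_borel_affine.

(** * Inversion of integrals over R^n *)

Section kelvin_invariance.
Local Open Scope ereal_scope.
Context {R : realType} {n : nat}.
Hypothesis n0 : (0 < n)%N.
Local Notation mu := (lebesgue_rV_borel R n).
Implicit Types (f h : 'rV[R]_n -> \bar R) (x y : 'rV[R]_n) (t l r : R).

Lemma measurable_enormV :
  measurable_fun setT (fun x : 'rV[R]_n => (enorm x)^-1)%R.
Proof.
rewrite [X in measurable_fun _ X](_ : _ = (fun x : 'rV[R]_n => enorm x `^ (-1))%R).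
  exact: (measurableT_comp (measurable_powR (-1)%R) (@measurable_enorm R n)).
by apply/funext => x; rewrite powR_inv1// enorm_ge0.
Qed.

Lemma measurable_kelvin l : measurable_fun setT (@kelvin R n l).
Proof.
apply: measurable_fun_rVP => i.
rewrite (_ : _ \o _ = (fun x => l ^+ 2 * (enorm x)^-1 ^+ 2 * rV_coord i x)%R).
  apply: measurable_funM; last exact: measurable_rV_coord.
  by apply: measurable_funM => //; apply: measurable_funX; exact: measurable_enormV.
by apply/funext => x; rewrite /= /rV_coord !mxE exprVn.
Qed.

Lemma lebesgue_rV_borel_set1 x : mu [set x] = 0.
Proof.
pose A i : set (measurableTypeR R) := [set x ord0 i].
rewrite (_ : [set x] = [set y | forall i, A i (y ord0 i)]).
  rewrite lebesgue_rV_borel_box//; last by move=> i; exact: measurable_set1.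
  by rewrite (bigD1 (Ordinal n0))//= lebesgue_measure_set1 mul0e.
by apply/seteqP; split => [y -> i//|y Ay]; apply/rowP => i; rewrite (Ay i).
Qed.

Lemma measurable_rV_set1 x : measurable [set x].
Proof.
rewrite (_ : [set x] = \bigcap_(i in [set: 'I_n]) (@rV_coord R n i @^-1` [set x ord0 i])).
  apply: fin_bigcap_measurable => // i _.
  by rewrite -[X in measurable X]setTI; exact: measurable_rV_coord.
by apply/seteqP; split => [y -> i//|y Ay]; apply/rowP => i; exact: (Ay i).
Qed.

Lemma measurable_enorm_preimage (A : set (measurableTypeR R)) :
  measurable A -> measurable [set x : 'rV[R]_n | A (enorm x)].
Proof. by move=> mA; rewrite -[X in measurable X]setTI; exact: measurable_enorm. Qed.

Lemma measurable_enorm_gt r : measurable [set x : 'rV[R]_n | (r < enorm x)%R].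
Proof.
rewrite (_ : [set x | _] = [set x : 'rV[R]_n | `]r, +oo[%classic (enorm x)]).
  exact: measurable_enorm_preimage.
by apply/seteqP; split => x /=; rewrite in_itv/= andbT.
Qed.

(** The density |x|^-n of the dilation-invariant measure. It is 0 at the origin, because 0^-1 = 0
    and n > 0, so the origin contributes nothing to the weighted integrals. *)
Let w x : \bar R := ((enorm x)^-1 ^+ n)%:E.

Let w_ge0 x : 0 <= w x.
Proof. by rewrite lee_fin exprn_ge0// invr_ge0 enorm_ge0. Qed.

Let measurable_w : measurable_fun setT w.
Proof. by apply/measurable_EFinP; apply: measurable_funX; exact: measurable_enormV. Qed.

Let dilation_invariant t f : (0 < t)%R -> measurable_fun setT f -> (forall x, 0 <= f x) ->
  \int[mu]_x (f (t *: x)%R * w x) = \int[mu]_x (f x * w x).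
Proof.
move=> t0 mf f0.
rewrite -[RHS](@ge0_integral_rV_affine _ _ t 0)//; last 2 first.
- exact: emeasurable_funM.
- by move=> x; exact: mule_ge0.
rewrite -ge0_integralZl//; last 3 first.
- apply: (measurableT_comp (f := fun x => f x * w x)).
    exact: emeasurable_funM.
  exact: measurable_rV_affine.
- by move=> x _; exact: mule_ge0.
- by rewrite lee_fin exprn_ge0// ltW.
apply: eq_integral => x _; rewrite addr0 muleCA; congr (_ * _).
rewrite /w enormZ gtr0_norm// -EFinM -exprMn invfM mulrA divff ?gt_eqF//.
by rewrite mul1r.
Qed.

Let phi : R -> \bar R := fun s => (\1_(`[0, 1[ : set R) s)%:E.

Let phi_ge0 s : 0 <= phi s. Proof. by rewrite lee_fin. Qed.

Let measurable_phi : measurable_fun setT phi.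
Proof. by apply/measurable_EFinP; exact: measurable_indic. Qed.

Let integral_phi b : \int[lebesgue_measure]_s phi (b - s)%R = 1.
Proof.
rewrite (@ge0_integral_reflect _ b phi)// /phi integral_indic// setIT.
have := lebesgue_measure_itv `[0%R:R, 1%R[; rewrite /= lte_fin ltr01 oppr0 adde0; exact.
Qed.

Let measurable_scale : measurable_fun setT
  (fun z : 'rV[R]_n * measurableTypeR R => expR z.2 *: z.1)%R.
Proof.
apply: measurable_fun_rVP => i.
rewrite (_ : _ \o _ = (fun z : 'rV[R]_n * measurableTypeR R => expR z.2 * rV_coord i z.1)%R).
  apply: measurable_funM.
    by apply: (measurableT_comp (@measurable_expR R)); exact: measurable_snd.
  by apply: (measurableT_comp (@measurable_rV_coord R n i)); exact: measurable_fst.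
by apply/funext => x; rewrite /= /rV_coord !mxE.
Qed.

(* Averaging over the dilation group, with phi(ln |x| - s) ds of total mass 1,
   replaces f by its mean along the ray through x. *)
Lemma ge0_integral_dilation_average f : measurable_fun setT f -> (forall x, 0 <= f x) ->
  \int[mu]_x (f x * w x) =
  \int[mu]_x (phi (ln (enorm x)) * w x * \int[lebesgue_measure]_s f (expR s *: x)%R).
Proof.
move=> mf f0.
have mfw : measurable_fun setT (fun x => f x * w x) by exact: emeasurable_funM.
have mphiln : measurable_fun setT
    (fun z : 'rV[R]_n * measurableTypeR R => phi (ln (enorm z.1) - z.2)%R).
  apply: measurableT_comp; first exact: measurable_phi.
  apply: measurable_funB; last exact: measurable_snd.
  apply: (measurableT_comp (@measurable_ln R)).
  by apply: (measurableT_comp (@measurable_enorm R n)); exact: measurable_fst.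
transitivity (\int[mu]_x \int[lebesgue_measure]_s (f x * w x * phi (ln (enorm x) - s)%R)).
  apply: eq_integral => x _; rewrite ge0_integralZl//.
  - by rewrite integral_phi mule1.
  - apply: (measurableT_comp measurable_phi).
    exact: measurable_funB.
  - exact: mule_ge0.
rewrite (@fubini_tonelli _ _ _ _ _ mu lebesgue_measure
  (fun z => f z.1 * w z.1 * phi (ln (enorm z.1) - z.2)%R))/=; last 2 first.
- apply: emeasurable_funM => //.
  by apply: (measurableT_comp mfw); exact: measurable_fst.
- by move=> z; rewrite !mule_ge0.
transitivity (\int[lebesgue_measure]_s \int[mu]_x
    (f (expR s *: x)%R * w x * phi (ln (enorm x)))).
  apply: eq_integral => s _.
  pose g y := f y * phi (ln (enorm y) - s)%R.
  transitivity (\int[mu]_x (g (expR s *: x)%R * w x)).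
    rewrite dilation_invariant ?expR_gt0//.
    - by apply: eq_integral => x _; rewrite muleAC.
    - apply: emeasurable_funM => //; apply: (measurableT_comp measurable_phi).
      apply: measurable_funB => //; apply: (measurableT_comp (@measurable_ln R)).
      exact: measurable_enorm.
    - by move=> x; rewrite mule_ge0.
  apply: eq_integral => x _; rewrite /g.
  have [->|x0] := eqVneq x (0%R : 'rV[R]_n).
    by rewrite /w enorm0 invr0 expr0n gtn_eqF// !mule0 mul0e.
  rewrite enormZ ger0_norm ?expR_ge0// lnM ?posrE ?expR_gt0 ?enorm_gt0//.
  by rewrite expRK addrAC subrr add0r muleAC.
rewrite -(@fubini_tonelli _ _ _ _ _ mu lebesgue_measure
  (fun z => f (expR z.2 *: z.1)%R * w z.1 * phi (ln (enorm z.1))))/=; last 2 first.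
- apply: emeasurable_funM.
    apply: emeasurable_funM; first exact: measurableT_comp.
    by apply: (measurableT_comp measurable_w); exact: measurable_fst.
  apply: (measurableT_comp measurable_phi); apply: (measurableT_comp (@measurable_ln R)).
  by apply: (measurableT_comp (@measurable_enorm R n)); exact: measurable_fst.
- by move=> z; rewrite !mule_ge0.
apply: eq_integral => x _.
rewrite -ge0_integralZl//; last 2 first.
- apply: (measurableT_comp mf).
  exact: (measurableT_comp measurable_scale (measurable_pair1 x)).
- exact: mule_ge0.
by apply: eq_integral => s _; rewrite -muleA muleC (muleC (w x)).
Qed.

(** After averaging over dilations only the integral of f(e^s x) over s matters, and there inversion
    is the reflection s -> ln((l/|x|)^2) - s, which preserves Lebesgue measure on the line. *)
Lemma ge0_integral_kelvin_weight l f : (0 < l)%R ->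
  measurable_fun setT f -> (forall x, 0 <= f x) ->
  \int[mu]_x (f (kelvin l x) * w x) = \int[mu]_x (f x * w x).
Proof.
move=> l0 mf f0.
rewrite ge0_integral_dilation_average//; last by apply: measurableT_comp => //; exact: measurable_kelvin.
rewrite [RHS](ge0_integral_dilation_average mf f0).
apply: eq_integral => x _.
have [->|x0] := eqVneq x (0%R : 'rV[R]_n).
  by rewrite /w enorm0 invr0 expr0n gtn_eqF// !mule0 !mul0e.
congr (_ * _).
have mfx : measurable_fun setT (fun s : measurableTypeR R => f (expR s *: x)%R).
  apply: (measurableT_comp mf).
  exact: (measurableT_comp measurable_scale (measurable_pair1 x)).
rewrite -[RHS](@ge0_integral_reflect _ (ln ((l / enorm x) ^+ 2)))//.
apply: eq_integral => s _; congr f.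
have ex : (0 < enorm x)%R by rewrite enorm_gt0.
rewrite /kelvin enormZ gtr0_norm ?expR_gt0// scalerA expRD expRN lnK; last first.
  by rewrite posrE exprn_gt0// divr_gt0.
congr (_ *: _)%R; have := expR_gt0 s; move: ex => /lt0r_neq0 ? /lt0r_neq0 ?.
by field; apply/andP.
Qed.

(** Each ray meets the sphere for a single value of s, so the dilation average of its indicator
    vanishes; on the sphere the weight is the positive constant r^-n. *)
Lemma lebesgue_rV_borel_sphere r : (0 < r)%R -> mu [set x | enorm x = r] = 0.
Proof.
move=> r0; set S := (X in mu X).
have mS : measurable S by exact: (@measurable_enorm_preimage [set r]).
have : \int[mu]_x ((\1_S x)%:E * w x) = 0.
  rewrite ge0_integral_dilation_average//; last first.
    by apply/measurable_EFinP; exact: measurable_indic.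
  apply: integral0_eq => x _.
  rewrite (_ : \int[lebesgue_measure]_s _ = 0) ?mule0//.
  have [->|x0] := eqVneq x (0%R : 'rV[R]_n).
    apply: integral0_eq => s _; rewrite scaler0 indicE memNset// /S /= enorm0.
    by move=> r00; move: r0; rewrite -r00 ltxx.
  rewrite (_ : (fun s => _) = (fun s => (\1_[set ln (r / enorm x)] s)%:E)).
    by rewrite integral_indic// setIT; exact: lebesgue_measure_set1.
  have ex : (0 < enorm x)%R by rewrite enorm_gt0.
  apply/funext => s; congr (_%:E); rewrite !indicE; congr (_%:R); congr nat_of_bool.
  apply/idP/idP; rewrite !inE /S /= enormZ gtr0_norm ?expR_gt0//.
    by move=> <-; rewrite mulfK ?gt_eqF// expRK.
  by move=> ->; rewrite lnK ?posrE ?divr_gt0// divfK ?gt_eqF.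
rewrite (_ : (fun x => _) = (fun x => (r^-1 ^+ n)%:E * (\1_S x)%:E)); last first.
  apply/funext => x; rewrite muleC indicE.
  by have [|] := boolP (x \in S); rewrite ?mule0// !mule1 inE /w => ->.
rewrite ge0_integralZl//; last 2 first.
- by apply/measurable_EFinP; exact: measurable_indic.
- by rewrite lee_fin exprn_ge0// invr_ge0 ltW.
rewrite integral_indic// setIT => /eqP; rewrite mule_eq0 => /orP[|/eqP//].
by rewrite eqe expf_eq0 invr_eq0 gt_eqF// andbF.
Qed.

(** The origin and the sphere are null, and the ball is carried to the exterior by inversion; the
    factor (l/|x|)^(2n) is the Jacobian of the inversion. *)
Lemma ge0_integral_kelvin_fold l f : (0 < l)%R ->
  measurable_fun setT f -> (forall x, 0 <= f x) ->
  \int[mu]_x f x = \int[mu]_(x in [set x | (l < enorm x)%R])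
    (f x + f (kelvin l x) * ((l / enorm x) ^+ (2 * n))%:E).
Proof.
move=> l0 mf f0.
pose E : set 'rV[R]_n := [set x | (l < enorm x)%R].
pose I : set 'rV[R]_n := [set x | (0 < enorm x < l)%R].
have mE : measurable E by exact: measurable_enorm_gt.
have mI : measurable I.
  rewrite (_ : I = [set x | `]0%R, l[%classic (enorm x)]); last first.
    by apply/seteqP; split => x /=; rewrite in_itv.
  exact: measurable_enorm_preimage.
have mk : measurable_fun setT (f \o @kelvin R n l).
  by apply: measurableT_comp => //; exact: measurable_kelvin.
have ml : measurable_fun setT (fun x : 'rV[R]_n => ((l / enorm x) ^+ (2 * n))%:E).
  apply/measurable_EFinP; apply: measurable_funX; apply: measurable_funM => //.
  exact: measurable_enormV.
rewrite ge0_integralD//; last 3 first.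
- exact: measurable_funTS.
- by move=> x _; rewrite mule_ge0// lee_fin exprn_ge0// divr_ge0 ?enorm_ge0// ltW.
- by apply: measurable_funTS; exact: emeasurable_funM.
pose N : set 'rV[R]_n := [set 0%R] `|` [set x | enorm x = l].
have mS : measurable [set x : 'rV[R]_n | enorm x = l] by exact: (@measurable_enorm_preimage [set l]).
have mN : measurable N by apply: measurableU => //; exact: measurable_rV_set1.
have N0 : mu N = 0.
  rewrite measureU0//; [exact: lebesgue_rV_borel_set1|exact: measurable_rV_set1|].
  exact: lebesgue_rV_borel_sphere.
rewrite [LHS](@ge0_negligible_integral _ _ _ _ _ N)//.
rewrite (_ : _ `\` N = E `|` I); last first.
  apply/seteqP; split => x; rewrite /N /E /I /=.
    move=> [_ /not_orP[/eqP x0 /eqP xl]]; rewrite enorm_gt0 x0 /=.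
    by move: xl; rewrite neq_lt => /orP[]; tauto.
  move=> [lx|/andP[e0 el]]; split => // -[e|e].
  - by move: lx; rewrite e enorm0 => /(lt_trans l0); rewrite ltxx.
  - by rewrite e ltxx in lx.
  - by rewrite e enorm0 ltxx in e0.
  - by rewrite e ltxx in el.
rewrite ge0_integral_setU//; last 2 first.
- exact: measurable_funTS.
- by apply/disj_setPS => x [] /= lx /andP[_ /(lt_trans lx)]; rewrite ltxx.
congr (_ + _).
(* The interior integrand is rewritten against |x|^-n dx, where inversion acts without a factor. The
   Jacobian reappears as |kelvin l x|^n |x|^-n = (l/|x|)^(2n). *)
pose h x := (f x * (enorm x ^+ n)%:E) * (\1_I x)%:E.
have h0 x : 0 <= h x.
  by rewrite !mule_ge0// lee_fin exprn_ge0// enorm_ge0.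
have mh : measurable_fun setT h.
  apply: emeasurable_funM.
    apply: emeasurable_funM => //; apply/measurable_EFinP; apply: measurable_funX.
    exact: measurable_enorm.
  by apply/measurable_EFinP; exact: measurable_indic.
transitivity (\int[mu]_x (h x * w x)).
  rewrite integral_mkcond; apply: eq_integral => x _.
  rewrite patchE /h indicE; case: ifPn => xI; last by rewrite mule0 mul0e.
  rewrite mule1 -muleA -EFinM -exprMn divff ?expr1n ?mule1//.
  by move: xI; rewrite inE => /andP[/lt0r_neq0].
rewrite -(ge0_integral_kelvin_weight l0)// [RHS]integral_mkcond.
apply: eq_integral => x _; rewrite patchE /h indicE.
have -> : (kelvin l x \in I) = (x \in E).
  apply/idP/idP; rewrite !inE /I /E /= enorm_kelvin.
    have [->|x0] := eqVneq (enorm x) 0%R; first by rewrite invr0 mulr0 ltxx.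
    have ex : (0 < enorm x)%R by rewrite lt_neqAle eq_sym x0 enorm_ge0.
    by move=> /andP[_]; rewrite ltr_pdivrMr// expr2 ltr_pM2l.
  move=> lx; have ex : (0 < enorm x)%R by exact: lt_trans lx.
  by rewrite divr_gt0 ?exprn_gt0//= ltr_pdivrMr// expr2 ltr_pM2l.
case: ifPn => xE; last by rewrite mule0 mul0e.
rewrite mule1 -muleA -EFinM -exprMn enorm_kelvin exprM; congr (_ * (_ ^+ _)%:E).
by rewrite expr_div_n [in RHS]expr2 invfM mulrA.
Qed.

End kelvin_invariance.

(** * Conformal factors preserved by inversions *)

Section conformal_factor_line.
Context {R : realType}.
Implicit Types (s t a b A : R).

(** Real induction: by continuity the supremum of the points s of [a, b] with G a <= G s is again
    such a point, and a short good step would go past it. One arbitrarily short step at each point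
    is all that the inversion identity provides. *)
Lemma ndecr_of_frequent_increase (G : R -> R) : continuous G ->
  (forall s r, 0 < r -> exists h, [/\ 0 < h, h < r & G s <= G (s + h)]) ->
  forall a b, a <= b -> G a <= G b.
Proof.
move=> cG incG a b ab; rewrite leNgt; apply/negP => Gba.
pose S := [set s | a <= s <= b /\ G a <= G s].
have Sa : S a by split=> //=; rewrite lexx.
have hS : has_sup S by split; [exists a|exists b => s [/andP[]]].
have cb : sup S <= b by apply: ge_sup; [exists a|move=> s [/andP[]]].
have ac : a <= sup S by exact: ub_le_sup hS.2 _ Sa.
have Gc : G a <= G (sup S).
  rewrite leNgt; apply/negP => Gca.
  have /cvgrPdist_lt cGS := cG (sup S).
  have [r /= r0 rG] := cGS (G a - G (sup S)) ltac:(by rewrite subr_gt0).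
  have [s [/andP[sa sb] Gs] cs] := sup_adherent r0 hS.
  have sc : s <= sup S by apply: (ub_le_sup hS.2); split=> //; rewrite sa.
  have sr : `|sup S - s| < r by rewrite ger0_norm; lra.
  by have := rG s sr; rewrite /= distrC => /(le_lt_trans (ler_norm _)); lra.
have [cb'|bc] := ltP (sup S) b; last first.
  by move: Gba; rewrite -(@le_anti _ _ (sup S) b) ?cb// => /(le_lt_trans Gc); rewrite ltxx.
have [h [h0 hr Gh]] := incG (sup S) (b - sup S) ltac:(by rewrite subr_gt0).
have : S (sup S + h) by split; [apply/andP; split; lra|exact: le_trans Gh].
by move=> /(ub_le_sup hS.2); lra.
Qed.

Variable V : R -> R.
Hypothesis cV : continuous V.
Hypothesis V0 : forall s, 0 < V s.
Hypothesis inversion_V : forall s t, s < t ->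
  V s * V t = (t - s) ^+ 2 * V (s + V s / (t - s)).

Let F s := V s - s ^+ 2.

(** With h = V s / (t - s), the inversion identity says that F has the same slope on [s, s + h] as
    on [s, t]. The bracket is that slope split around [A]: its first term has the sign of F t - A t,
    and its last one tends to 0 as t grows. *)
Let F_increment A s t : s < t -> F (s + V s / (t - s)) - F s =
  V s / (t - s) * ((V t - t ^+ 2 - A * t) / (t - s) + A + (A * s + s ^+ 2 - V s) / (t - s)).
Proof.
move=> st; have ts : t - s != 0 by rewrite subr_eq0 gt_eqF.
rewrite /F (_ : V (s + V s / (t - s)) = V s * V t / (t - s) ^+ 2); first by field.
by rewrite inversion_V// mulrAC divff ?mul1r// sqrf_eq0.
Qed.

Let continuous_F A : continuous (fun s => F s - A * s).
Proof.
move=> s; apply: cvgB; last by apply: cvgM; [exact: cvg_cst|exact: cvg_id].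
by apply: cvgB; [exact: cV|exact: exprn_continuous].
Qed.

(* A point t far to the right controls the increment of F on the short
   interval from s to s + V s / (t - s). *)
Let short_increment A s r e : 0 < r -> 0 < e -> exists T, s < T /\ forall t, T < t ->
  [/\ 0 < V s / (t - s), V s / (t - s) < r &
      `|(A * s + s ^+ 2 - V s) / (t - s)| < e].
Proof.
move=> r0 e0; set K := A * s + _ - _.
exists (s + V s / r + `|K| / e); have Vr : 0 < V s / r by rewrite divr_gt0.
have Ke : 0 <= `|K| / e by rewrite divr_ge0// ltW.
split=> [|t Tt]; first lra.
have ts : 0 < t - s by lra.
split; first by rewrite divr_gt0.
  by rewrite ltr_pdivrMr// mulrC -ltr_pdivrMr//; lra.
by rewrite normrM normfV (gtr0_norm ts) ltr_pdivrMr// mulrC -ltr_pdivrMr//; lra.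
Qed.

Let slope_ge A : (forall T, exists2 t, T < t & t ^+ 2 + A * t <= V t) ->
  forall a b, a <= b -> A * (b - a) <= F b - F a.
Proof.
move=> freq a b ab; apply/ler_addgt0Pr => e e0.
(* The slope [A] is relaxed by this amount to absorb the error term; over [a, b] this costs at most
   [e]. The summand 1 keeps the denominator positive when a = b. *)
have d0 : 0 < e / (b - a + 1) by rewrite divr_gt0//; lra.
have : F a - (A - e / (b - a + 1)) * a <= F b - (A - e / (b - a + 1)) * b.
  apply: (@ndecr_of_frequent_increase (fun s => F s - (A - e / (b - a + 1)) * s)) => // s r r0.
  have [T [sT HT]] := @short_increment A s r _ r0 d0.
  have [t Tt tV] := freq T; have [h0 hr hK] := HT _ Tt.
  exists (V s / (t - s)); split => //.
  have ts : 0 < t - s by rewrite subr_gt0 (lt_trans sT).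
  have : 0 <= F (s + V s / (t - s)) - F s - (A - e / (b - a + 1)) * (V s / (t - s)).
    rewrite (@F_increment A) ?(lt_trans sT)// [_ * (V s / _)]mulrC -mulrBr.
    rewrite mulr_ge0 ?(ltW h0)//.
    have : 0 <= (V t - t ^+ 2 - A * t) / (t - s) by rewrite divr_ge0 ?(ltW ts)//; lra.
    by move: hK; rewrite ltr_norml => /andP[]; lra.
  lra.
have : e / (b - a + 1) * (b - a) <= e.
  by rewrite mulrAC ler_pdivrMr; [rewrite ler_pM2l//; lra|lra].
lra.
Qed.

Let slope_le A : (exists T, forall t, T < t -> V t < t ^+ 2 + A * t) ->
  forall a b, a <= b -> F b - F a <= A * (b - a).
Proof.
move=> [T0 ev] a b ab; apply/ler_addgt0Pr => e e0.
have d0 : 0 < e / (b - a + 1) by rewrite divr_gt0//; lra.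
have : - (F a - (A + e / (b - a + 1)) * a) <= - (F b - (A + e / (b - a + 1)) * b).
  apply: (@ndecr_of_frequent_increase (fun s => - (F s - (A + e / (b - a + 1)) * s))) => //.
    by move=> s; apply: cvgN; exact: continuous_F.
  move=> s r r0; have [T [sT HT]] := @short_increment A s r _ r0 d0.
  pose t := Num.max T0 T + 1.
  have Tt : T < t by rewrite ltr_pwDr// le_max lexx orbT.
  have tV : V t < t ^+ 2 + A * t by apply: ev; rewrite ltr_pwDr// le_max lexx.
  have [h0 hr hK] := HT _ Tt.
  exists (V s / (t - s)); split => //.
  have ts : 0 < t - s by rewrite subr_gt0 (lt_trans sT).
  have : F (s + V s / (t - s)) - F s - (A + e / (b - a + 1)) * (V s / (t - s)) <= 0.
    rewrite (@F_increment A) ?(lt_trans sT)// [_ * (V s / _)]mulrC -mulrBr.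
    rewrite pmulr_rle0//.
    have : (V t - t ^+ 2 - A * t) / (t - s) <= 0 by rewrite pmulr_lle0 ?invr_gt0//; lra.
    by move: hK; rewrite ltr_norml => /andP[]; lra.
  lra.
have : e / (b - a + 1) * (b - a) <= e.
  by rewrite mulrAC ler_pdivrMr; [rewrite ler_pM2l//; lra|lra].
lra.
Qed.

(** Either F t >= A t for arbitrarily large t, or F t < A t eventually; so every number [A] bounds
    all slopes of F from the same side. The midpoint of two distinct slopes would violate this,
    hence F is affine. No limit of F t / t has to be shown to exist beforehand. *)
Lemma conformal_factor_line : forall s, V s = s ^+ 2 + (F 1 - F 0) * s + V 0.
Proof.
have dich A : (forall a b, a <= b -> A * (b - a) <= F b - F a) \/
    (forall a b, a <= b -> F b - F a <= A * (b - a)).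
  have [freq|/existsNP[T noT]] :=
    pselect (forall T, exists2 t, T < t & t ^+ 2 + A * t <= V t).
    by left; exact: slope_ge.
  right; apply: slope_le; exists T => t Tt; rewrite ltNge; apply/negP => tV.
  by apply: noT; exists t.
have slope a b : a < b -> F b - F a = (F 1 - F 0) * (b - a).
  move=> ab; have ba : 0 < b - a by rewrite subr_gt0.
  set A1 := F 1 - F 0; pose A2 := (F b - F a) / (b - a).
  have A2E : F b - F a = A2 * (b - a) by rewrite /A2 divfK// gt_eqF.
  suff -> : A1 = A2 by [].
  apply/eqP; case: (dich ((A1 + A2) / 2)) => sl;
    have := sl 0 1 ler01; have := sl a b (ltW ab); rewrite A2E subr0 mulr1 -/A1;
    rewrite ler_pM2r// => h1 h2; apply/eqP; lra.
move=> s; suff : F s - F 0 = (F 1 - F 0) * s by rewrite {1 2}/F expr0n/=; lra.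
have [s0|s0|->] := ltgtP s 0; last by rewrite subrr mulr0.
  by have := slope _ _ s0; lra.
by have := slope _ _ s0; lra.
Qed.

End conformal_factor_line.

Section conformal_factor.
Context {R : realType} {n : nat}.
Implicit Types x y e w : 'rV[R]_n.

(** A line is parametrised by a unit vector, so that squared distances on it are (t - s)^2 and the
    identity for [v] becomes the one of [conformal_factor_line]. Then v - |x|^2 is affine on every
    line, hence affine on R^n, and [v] is found by completing the square. *)
Lemma conformal_factor_quadratic (v : 'rV[R]_n -> R) :
  (forall x, 0 < v x) ->
  (forall x e, continuous (fun t : R => v (x + t *: e))) ->
  (forall x y, x != y ->
    v x * v y = enorm (y - x) ^+ 2 * v (x + (v x / enorm (y - x) ^+ 2) *: (y - x))) ->
  exists d xbar, 0 < d /\ forall x, v x = d + enorm (x - xbar) ^+ 2.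
Proof.
move=> v0 cv vI; pose P x := v x - enorm x ^+ 2.
have Pline1 x e t : enorm e = 1 -> P (x + t *: e) = P x + t * (P (x + e) - P x).
  move=> e1; have e0 : e != 0 by rewrite -enorm_gt0 e1.
  have VI (s r : R) : s < r -> v (x + s *: e) * v (x + r *: e) =
      (r - s) ^+ 2 * v (x + (s + v (x + s *: e) / (r - s)) *: e).
    move=> sr; have rs : r - s != 0 by rewrite subr_eq0 gt_eqF.
    have E : x + r *: e - (x + s *: e) = (r - s) *: e.
      by rewrite opprD addrACA subrr add0r scalerBl.
    rewrite vI ?E ?enormZ ?e1 ?mulr1 ?real_normK ?num_real//; last first.
      by rewrite eq_sym -subr_eq0 E scaler_eq0 negb_or rs.
    congr (_ * v _); rewrite scalerA -addrA -scalerDl; congr (_ + _ *: _).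
    by field.
  have H := conformal_factor_line (cv x e) (fun s => v0 _) VI.
  have := H t; have := H 1; rewrite /= !scale0r !addr0 !scale1r /P.
  by rewrite !sqr_enorm !(dotpDl, dotpDr, dotpZl, dotpZr) (dotpC e x) -(sqr_enorm e) e1; lra.
have Pline x w t : P (x + t *: w) = P x + t * (P (x + w) - P x).
  have [->|w0] := eqVneq w 0; first by rewrite scaler0 !addr0 subrr mulr0 addr0.
  have ew : enorm w != 0 by rewrite enorm_eq0.
  have [e e1 wE] : exists2 e, enorm e = 1 & w = enorm w *: e.
    exists ((enorm w)^-1 *: w); last by rewrite scalerA divff// scale1r.
    by rewrite enormZ ger0_norm ?invr_ge0 ?enorm_ge0// mulVf.
  have Pw : P (x + w) = P x + enorm w * (P (x + e) - P x) by rewrite {1}wE Pline1.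
  by rewrite Pw {1}wE scalerA Pline1//; ring.
pose L x := P x - P 0.
have LZ t x : L (t *: x) = t * L x.
  by rewrite /L -[t *: x]add0r Pline add0r addrAC subrr add0r.
have LD x y : L (x + y) = L x + L y.
  (* Affinity on lines gives homogeneity of [L] directly; additivity comes from the midpoint of x
     and y, which lies on the line through them. *)
  have -> : x + y = 2 *: (x + 2^-1 *: (y - x)).
    rewrite scalerDr scalerA divff// scale1r scaler_nat mulr2n.
    by rewrite -addrA [x + (y - x)]addrC subrK.
  by rewrite LZ /L Pline [x + (y - x)]addrC subrK; field.
pose b : 'rV[R]_n := \row_i L (delta_mx 0 i).
have LE x : L x = dotp x b.
  rewrite {1}[x]row_sum_delta (big_morph L LD (_ : L 0 = 0)) /L ?subrr//.
  by apply: eq_bigr => i _; rewrite -/(L _) LZ mxE.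
have vE x : v x = enorm x ^+ 2 + dotp x b + P 0 by have := LE x; rewrite /L /P; lra.
pose xbar : 'rV[R]_n := (- 2^-1) *: b.
(* The constant term is the value of [v] at the vertex of the paraboloid, so its positivity is an
   instance of [v0]. *)
exists (v xbar), xbar; split => // x; rewrite !vE /xbar !sqr_enorm.
rewrite !(dotpDl, dotpDr, dotpNl, dotpNr, dotpZl, dotpZr) (dotpC b x).
  by field.
Qed.

End conformal_factor.

(** * Moving spheres *)

Section powR_estimates.
Context {R : realType}.
Implicit Types x y p q : R.

Lemma powRV x p : 0 <= x -> x^-1 `^ p = (x `^ p)^-1.
Proof. by move=> x0; rewrite -powR_inv1// -powRrM mulN1r powRN. Qed.

Lemma powR_ge1 x p : 0 <= p -> 1 <= x -> 1 <= x `^ p.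
Proof. by move=> p0 x1; rewrite -(powRr0 x); exact: ler_powR. Qed.

Lemma ler_powRN x y q : 0 <= q -> 0 < x -> x <= y -> y `^ (- q) <= x `^ (- q).
Proof.
move=> q0 x0 xy; rewrite !powRN lef_pV2 ?posrE ?powR_gt0 ?(lt_le_trans x0)//.
by rewrite ge0_ler_powR// nnegrE ltW// (lt_le_trans x0).
Qed.

(** The convex function t^-q lies above its tangent at [x]. Divided by x^-q this reads 1 - q (y/x -
    1) <= (x/y)^q, which follows from exp t >= 1 + t and ln t <= t - 1. *)
Lemma powRN_sub_le x y q : 0 < q -> 0 < x -> x <= y ->
  x `^ (- q) - y `^ (- q) <= q * x `^ (- q - 1) * (y - x).
Proof.
move=> q0 x0 xy; have y0 : 0 < y by exact: lt_le_trans xy.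
have yE : y `^ (- q) = x `^ (- q) * (x / y) `^ q.
  rewrite powRM ?invr_ge0 ?(ltW x0) ?(ltW y0)// powRV ?(ltW y0)// !powRN mulrA.
  by rewrite mulVf ?mul1r// powR_eq0 gt_eqF.
have -> : x `^ (- q - 1) = x `^ (- q) / x.
  by rewrite powRB ?powRr1 ?(ltW x0)// (gt_eqF x0) implybT.
have t0 : 0 < x / y by rewrite divr_gt0.
have tq : 1 - q * (y / x - 1) <= (x / y) `^ q.
  rewrite /powR gt_eqF//; apply: le_trans (expR_ge1Dx _); rewrite lerD2l.
  have yx : 0 < y / x by rewrite divr_gt0.
  have : ln (y / x) <= y / x - 1.
    by rewrite -{1}[y / x](subrK 1) addrC; apply: le_ln1Dx; lra.
  have -> : ln (x / y) = - ln (y / x) by rewrite -lnV ?posrE ?divr_gt0// invf_div.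
  by move=> H; rewrite mulrN lerN2 ler_pM2l.
rewrite yE -[X in X - _]mulr1 -mulrBr -!mulrA mulrCA ler_pM2l ?powR_gt0//.
have -> : q * (x^-1 * (y - x)) = q * (y / x - 1) by field; rewrite gt_eqF.
lra.
Qed.

Lemma powRD_le x y p : 0 < p -> 0 <= x -> 0 <= y ->
  (x + y) `^ p <= 2 `^ p * (x `^ p + y `^ p).
Proof.
move=> p0 x0 y0; wlog xy : x y x0 y0 / x <= y => [H|].
  by have [xy|/ltW yx] := leP x y; [exact: H|rewrite addrC [_ + y `^ p]addrC; exact: H].
apply: (@le_trans _ _ ((2 * y) `^ p)).
  by rewrite ge0_ler_powR ?nnegrE ?(ltW p0)// ?addr_ge0// ?mulr_ge0//; lra.
by rewrite powRM// ler_pM2l ?powR_gt0// lerDr powR_ge0.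
Qed.

(** Zeros of [h] are treated apart: the derivative of the power is used only at positive arguments,
    and at a zero monotonicity and p > 0 suffice. Such zeros occur for |x - y| along a line through
    y. *)
Lemma continuous_powR_comp (h : R -> R) p : 0 < p -> continuous h ->
  (forall s, 0 <= h s) -> continuous (fun s => h s `^ p).
Proof.
move=> p0 ch h0 s; have [hs0|hs0] := eqVneq (h s) 0; last first.
  have hs : 0 < h s by rewrite lt_neqAle eq_sym hs0 h0.
  have dp : differentiable (@powR R ^~ p) (h s).
    by apply/derivable1_diffP; apply: derivable_powR; rewrite in_itv/= hs.
  have cp : {for h s, continuous (@powR R ^~ p)} := differentiable_continuous dp.
  exact: (continuous_comp (ch s) cp).
rewrite /continuous_at hs0 powR0 ?gt_eqF//; apply/cvgrPdist_lt => e e0.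
have /cvgrPdist_lt/(_ (e `^ p^-1)) := ch s.
rewrite powR_gt0// => /(_ isT); apply: filterS => t.
rewrite hs0 !sub0r !normrN ger0_norm// ger0_norm ?powR_ge0// => ht.
have := @gt0_ltr_powR _ _ p0 (h t) (e `^ p^-1); rewrite !nnegrE powR_ge0 h0.
by move=> /(_ isT isT ht); rewrite -powRrM mulVf ?gt_eqF// powRr1// ltW.
Qed.

End powR_estimates.

Section enorm_estimates.
Context {R : realType} {n : nat}.
Implicit Types x y v w : 'rV[R]_n.

Lemma continuous_enorm_line v w : continuous (fun s : R => enorm (v + s *: w)).
Proof.
move=> s; apply/cvgrPdist_lt => e e0.
have w1 : 0 < enorm w + 1 by rewrite ltr_wpDl// enorm_ge0.
apply: filterS (nbhsx_ballx s _ (divr_gt0 e0 w1)) => t st.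
apply: (@le_lt_trans _ _ (`|s - t| * enorm w)); last first.
  apply: (@le_lt_trans _ _ (`|s - t| * (enorm w + 1))).
    by rewrite ler_wpM2l// lerDl.
  by rewrite -ltr_pdivlMr.
have E (r r' : R) : enorm (v + r *: w) <= enorm (v + r' *: w) + `|r - r'| * enorm w.
  rewrite -enormZ; apply: le_trans (enormD _ _).
  by rewrite -addrA -scalerDl [r' + _]addrC subrK.
rewrite ler_norml; apply/andP; split.
  by have := E t s; rewrite distrC; lra.
by have := E s t; lra.
Qed.

(** A product form of the triangle inequality: it separates the variables of the kernel and so
    bounds a solution by a multiple of (1 + |x|)^p. *)
Lemma enorm_dist_le x y : enorm (x - y) <= (1 + enorm x) * (1 + enorm y).
Proof. by apply: le_trans (enormB _ _) _; have := mulr_ge0 (enorm_ge0 x) (enorm_ge0 y); lra. Qed.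

(** No [y] is close to both points, and far away each distance is comparable to 1 + |y|. Hence
    finiteness of u at two points controls the integral of u^-q against (1 + |y|)^p. *)
Lemma weight_le_dist (p : R) x1 x2 : 0 < p -> x1 != x2 -> exists2 C : R, 0 < C &
  forall y, (1 + enorm y) `^ p <= C * (enorm (x1 - y) `^ p + enorm (x2 - y) `^ p).
Proof.
move=> p0 x12; pose d := enorm (x1 - x2).
have d0 : 0 < d by rewrite enorm_gt0 subr_eq0.
pose K := (1 + enorm x1) / d + 1.
have K0 : 0 < K by rewrite ltr_wpDl// divr_ge0 ?(ltW d0)// addr_ge0 ?enorm_ge0.
exists (K `^ p * 2 `^ p) => [|y]; first by rewrite mulr_gt0 ?powR_gt0.
have sge0 : 0 <= enorm (x1 - y) + enorm (x2 - y) by rewrite addr_ge0 ?enorm_ge0.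
rewrite -mulrA; apply: (@le_trans _ _ ((K * (enorm (x1 - y) + enorm (x2 - y))) `^ p)).
  rewrite ge0_ler_powR ?nnegrE ?addr_ge0 ?mulr_ge0 ?enorm_ge0 ?(ltW p0) ?(ltW K0)//.
  have h1 : d <= enorm (x1 - y) + enorm (x2 - y).
    rewrite /d (_ : x1 - x2 = (x1 - y) - (x2 - y)) ?enormB//.
    by rewrite opprB addrA subrK.
  have h2 : enorm y <= enorm x1 + enorm (x1 - y).
    by have := enormB x1 (x1 - y); rewrite subKr.
  have h3 : 1 + enorm x1 <= (1 + enorm x1) / d * (enorm (x1 - y) + enorm (x2 - y)).
    rewrite mulrAC ler_pdivlMr// ler_pM2l//; by have := enorm_ge0 x1; lra.
  by have := enorm_ge0 (x2 - y); rewrite /K; lra.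
rewrite powRM ?(ltW K0)// ler_pM2l ?powR_gt0//.
exact: powRD_le (enorm_ge0 _) (enorm_ge0 _).
Qed.

End enorm_estimates.

Section moving_spheres.
Context {R : realType} {n : nat}.
Hypothesis n0 : (0 < n)%N.
Local Notation mu := (lebesgue_rV_borel R n).
Implicit Types (x y z : 'rV[R]_n) (l : R).
Variables p q : R.
Hypotheses (p0 : 0 < p) (q0 : 0 < q).
(** The defect from the critical exponent: 2n comes from the Jacobian, p from the kernel and -pq
    from u_l^-q, as [gE] shows. It vanishes exactly when q = 1 + 2n/p. *)
Let tau : R := (2 * n)%:R + p - p * q.
Hypothesis tau0 : 0 <= tau.
Variable u : 'rV[R]_n -> R.
Hypothesis u_gt0 : forall x, 0 < u x.
Hypothesis mu_u : measurable_fun setT u.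
Hypothesis u_eq : forall x,
  (u x)%:E = (\int[mu]_y (enorm (x - y) `^ p * u y `^ (- q))%:E)%E.

Lemma measurable_dist x : measurable_fun setT (fun y : 'rV[R]_n => enorm (x - y)).
Proof.
rewrite [X in measurable_fun _ X](_ : _ = @enorm R n \o (fun y => (-1) *: y + x)).
  by apply: measurableT_comp; [exact: measurable_enorm|exact: measurable_rV_affine].
by apply/funext => y; rewrite /= scaleN1r addrC.
Qed.

Let f y := u y `^ (- q).
Let f_gt0 y : 0 < f y. Proof. by rewrite powR_gt0. Qed.
Let mf : measurable_fun setT f.
Proof. exact: (measurableT_comp (measurable_powR (- q)) mu_u). Qed.

Let mdist x : measurable_fun setT (fun y : 'rV[R]_n => enorm (x - y) `^ p).
Proof. exact: (measurableT_comp (measurable_powR p) (measurable_dist x)). Qed.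

Lemma exists_enorm (r : R) : 0 <= r -> exists x : 'rV[R]_n, enorm x = r.
Proof.
move=> r0; pose w : 'rV[R]_n := const_mx 1.
have w0 : 0 < enorm w.
  rewrite enorm_gt0; apply/eqP => /rowP/(_ (Ordinal n0)); rewrite !mxE.
  by move/eqP; rewrite oner_eq0.
exists ((r / enorm w) *: w); rewrite enormZ ger0_norm ?divr_ge0 ?enorm_ge0//.
by rewrite divfK// gt_eqF.
Qed.

Definition kelvin_transform l x := (enorm x / l) `^ p * u (kelvin l x).
Local Notation ul := kelvin_transform.

(** * Folding the equation onto the exterior of a sphere *)

Let E l : set 'rV[R]_n := [set x | l < enorm x].
Let mE l : measurable (E l). Proof. exact: measurable_enorm_gt. Qed.
(** [a] is the kernel and [b] its Kelvin transform in [x]; [g] is [f] after inversion, with the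
    Jacobian and the factor of [z] from [kelvin_dist]. Transforming the kernel in both variables
    gives back [a], so u integrates a f + b g and u_l integrates b f + a g. *)
Let a x z := enorm (x - z) `^ p.
Let b l x z := (enorm x / l * enorm (kelvin l x - z)) `^ p.
Let g l z := f (kelvin l z) * (l / enorm z) ^+ (2 * n) * (l / enorm z) `^ p.

Let mg l : measurable_fun setT (g l).
Proof.
have mV : measurable_fun setT (fun z : 'rV[R]_n => l / enorm z).
  by apply: measurable_funM => //; exact: measurable_enormV.
apply: measurable_funM; last exact: (measurableT_comp (measurable_powR p) mV).
apply: measurable_funM; last exact: measurable_funX.
exact: (measurableT_comp mf (measurable_kelvin l)).
Qed.

Let mb l x : measurable_fun setT (b l x).
Proof.
apply: (measurableT_comp (measurable_powR p)); apply: measurable_funM => //.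
exact: measurable_dist.
Qed.

Let ul_gt0 l x : 0 < l -> l < enorm x -> 0 < ul l x.
Proof. by move=> l0 lx; rewrite mulr_gt0// powR_gt0// divr_gt0// (lt_trans l0). Qed.

Lemma measurable_kelvin_transform l : measurable_fun setT (ul l).
Proof.
apply: measurable_funM; last exact: (measurableT_comp mu_u (measurable_kelvin l)).
have mV : measurable_fun setT (fun z : 'rV[R]_n => enorm z / l).
  by apply: measurable_funM => //; exact: measurable_enorm.
exact: (measurableT_comp (measurable_powR p) mV).
Qed.

Let gE l z : 0 < l -> l < enorm z -> g l z = (l / enorm z) `^ tau * ul l z `^ (- q).
Proof.
move=> l0 lz; have z0 : 0 < enorm z by exact: lt_trans lz.
have r0 : 0 < l / enorm z by rewrite divr_gt0.
rewrite /g /kelvin_transform [X in _ = _ * X]powRM ?powR_ge0 ?(ltW (u_gt0 _))// -/(f _).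
rewrite -powRrM -[enorm z / l]invf_div powRV ?(ltW r0)// -powRN mulrN opprK.
rewrite -powR_mulrn ?(ltW r0)// -mulrA mulrC mulrA; congr (_ * _).
by rewrite -!powRD ?(gt_eqF r0) ?implybT//; congr powR; rewrite /tau; ring.
Qed.

Let g_gt0 l z : 0 < l -> l < enorm z -> 0 < g l z.
Proof.
move=> l0 lz; rewrite gE// mulr_gt0 ?powR_gt0 ?ul_gt0// divr_gt0//.
exact: lt_trans lz.
Qed.

Let g_le l z : 0 < l -> l < enorm z -> g l z <= ul l z `^ (- q).
Proof.
move=> l0 lz; have z0 : 0 < enorm z by exact: lt_trans lz.
rewrite gE// ler_piMl ?powR_ge0// -(powRr0 (l / enorm z)).
by rewrite ger_powR// divr_gt0//= ler_pdivrMr ?mul1r ?ltW.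
Qed.

Let a_ge0 x z : 0 <= a x z. Proof. exact: powR_ge0. Qed.
Let b_ge0 l x z : 0 <= b l x z. Proof. exact: powR_ge0. Qed.

Let a_lt_b l x z : 0 < l -> l < enorm x -> l < enorm z -> a x z < b l x z.
Proof.
move=> l0 lx lz; rewrite /a /b gt0_ltr_powR ?nnegrE ?enorm_ge0//.
  by rewrite mulr_ge0 ?divr_ge0 ?enorm_ge0 ?(ltW l0).
by rewrite mulrAC ltr_pdivlMr// mulrC kelvin_dist_lt.
Qed.

Let fold_u l x : 0 < l -> l < enorm x ->
  (u x)%:E = (\int[mu]_(z in E l) (a x z * f z + b l x z * g l z)%:E)%E.
Proof.
move=> l0 lx; rewrite u_eq (@ge0_integral_kelvin_fold _ _ n0 l)//; last 2 first.
- by apply/measurable_EFinP; exact: measurable_funM.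
- by move=> y; rewrite lee_fin mulr_ge0 ?powR_ge0.
apply: eq_integral => z; rewrite inE => /= lz.
have z0 : 0 < enorm z by exact: lt_trans lz.
have x0 : 0 < enorm x by exact: lt_trans lx.
rewrite -EFinM -EFinD; congr (_ + _)%:E.
have -> : enorm (x - kelvin l z) = enorm x / l * enorm (kelvin l x - z) * (l / enorm z).
  have := @kelvin_dist _ _ l x z; rewrite -!enorm_gt0 => /(_ x0 z0) H.
  rewrite mulrACA [_ / l * _]mulrC; apply: (mulfI (lt0r_neq0 z0)); rewrite H.
  by field; rewrite !gt_eqF.
rewrite powRM ?mulr_ge0 ?invr_ge0 ?enorm_ge0 ?(ltW l0)// /b /g -/(f _).
by rewrite -!mulrA; congr (_ * _); rewrite mulrC -mulrA.
Qed.

Let fold_ul l x : 0 < l -> l < enorm x ->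
  (ul l x)%:E = (\int[mu]_(z in E l) (b l x z * f z + a x z * g l z)%:E)%E.
Proof.
move=> l0 lx; rewrite /kelvin_transform EFinM u_eq -ge0_integralZl//; last 3 first.
- by apply/measurable_EFinP; exact: measurable_funM.
- by move=> y _; rewrite lee_fin mulr_ge0 ?powR_ge0.
- by rewrite lee_fin powR_ge0.
rewrite (@ge0_integral_kelvin_fold _ _ n0 l)//; last 2 first.
- apply/measurable_EFinP; apply: measurable_funM => //.
  exact: measurable_funM.
- by move=> y; rewrite lee_fin !mulr_ge0 ?powR_ge0.
apply: eq_integral => z; rewrite inE => /= lz.
have z0 : 0 < enorm z by exact: lt_trans lz.
have x0 : 0 < enorm x by exact: lt_trans lx.
have xl : 0 <= enorm x / l by rewrite divr_ge0 ?ltW.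
rewrite -!EFinM -EFinD; congr (_ + _)%:E.
  by rewrite mulrA -powRM ?enorm_ge0.
rewrite mulrA -powRM ?enorm_ge0//.
have -> : enorm x / l * enorm (kelvin l x - kelvin l z) = enorm (x - z) * (l / enorm z).
  have xN0 : x != 0 by rewrite -enorm_gt0.
  have zN0 : z != 0 by rewrite -enorm_gt0.
  have lN0 : l != 0 by rewrite gt_eqF.
  have := @kelvin_dist _ _ l (kelvin l x) z (kelvin_neq0 lN0 xN0) zN0.
  rewrite kelvinK// enorm_kelvin => H; apply: (mulfI (lt0r_neq0 z0)).
  by rewrite mulrCA H; field; rewrite !gt_eqF.
rewrite powRM ?enorm_ge0 ?divr_ge0 ?enorm_ge0 ?(ltW l0)// /a /g -/(f _).
by rewrite -!mulrA; congr (_ * _); rewrite mulrC -mulrA.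
Qed.

(** The measure of the exterior is not computed: were the integral zero, the exterior would be null,
    and [fold_u] would give the value 0 to u at a point outside the sphere. *)
Let integral_exterior_gt0 l (h : 'rV[R]_n -> R) : 0 < l -> measurable_fun setT h ->
  (forall z, l < enorm z -> 0 < h z) -> (0 < \int[mu]_(z in E l) (h z)%:E)%E.
Proof.
move=> l0 mh h0; rewrite lt0e; apply/andP; split; last first.
  by apply: integral_ge0 => z /h0/ltW; rewrite lee_fin.
apply/eqP => Ih0.
have mhE : measurable_fun (E l) (EFin \o h).
  by apply: measurable_funTS; exact/measurable_EFinP.
have ae0 : ae_eq mu (E l) (EFin \o h) (cst 0%E).
  apply/ae_eq_integral_abs => //; rewrite -[RHS]Ih0.
  by apply: eq_integral => z; rewrite inE => /h0 hz; rewrite /= ger0_norm// ltW.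
have [x xl] := @exists_enorm (l + 1) ltac:(lra).
have lx : l < enorm x by lra.
have : (u x)%:E = 0%E; last first.
  by apply/eqP; rewrite eqe gt_eqF.
pose k z := (a x z * f z + b l x z * g l z)%:E.
rewrite (fold_u l0 lx).
transitivity (\int[mu]_(z in E l) `|k z|)%E.
  apply: eq_integral => z; rewrite inE => /= lz; rewrite /k /= ger0_norm//.
  by rewrite addr_ge0// mulr_ge0// ltW// g_gt0.
apply/ae_eq_integral_abs => //.
  apply: measurable_funTS; apply/measurable_EFinP.
  by apply: measurable_funD; apply: measurable_funM => //; exact: mdist.
by apply: filterS ae0 => z H lz; have := H lz; move=> [] hz; have := h0 z lz; rewrite hz ltxx.
Qed.

(** * Integrability, continuity, growth and the maximum principle *)

Let w y := (1 + enorm y) `^ p * f y.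

Let mw : measurable_fun setT w.
Proof.
apply: measurable_funM => //.
have m1 : measurable_fun setT (fun y : 'rV[R]_n => 1 + enorm y).
  by apply: measurable_funD => //; exact: measurable_enorm.
exact: (measurableT_comp (measurable_powR p) m1).
Qed.

Let w_ge0 y : 0 <= w y. Proof. by rewrite mulr_ge0 ?powR_ge0. Qed.

Let integral_w_lty : (\int[mu]_y (w y)%:E < +oo)%E.
Proof.
have [e e1] := @exists_enorm 1 ler01.
have e0 : 0 != e by rewrite eq_sym -enorm_gt0 e1.
have [C C0 HC] := weight_le_dist p0 e0.
apply: (@le_lt_trans _ _ (C * (u 0 + u e))%:E); last by rewrite ltry.
rewrite EFinM EFinD !u_eq -ge0_integralD//; last 4 first.
- by move=> y _; rewrite lee_fin mulr_ge0 ?powR_ge0.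
- by apply/measurable_EFinP; apply: measurable_funM => //; exact: mdist.
- by move=> y _; rewrite lee_fin mulr_ge0 ?powR_ge0.
- by apply/measurable_EFinP; apply: measurable_funM => //; exact: mdist.
rewrite -ge0_integralZl//; last 3 first.
- by apply: emeasurable_funD; apply/measurable_EFinP; apply: measurable_funM => //; exact: mdist.
- by move=> y _; rewrite adde_ge0// lee_fin mulr_ge0 ?powR_ge0.
- by rewrite lee_fin ltW.
apply: ge0_le_integral => //.
- by move=> y _; rewrite lee_fin.
- exact/measurable_EFinP.
- apply: emeasurable_funM => //; apply: emeasurable_funD;
    by apply/measurable_EFinP; apply: measurable_funM => //; exact: mdist.
move=> y _; rewrite -EFinD -EFinM lee_fin -mulrDl mulrA.
by rewrite ler_pM2r//; exact: HC.
Qed.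

Let integrable_w : mu.-integrable setT (EFin \o w).
Proof.
apply/integrableP; split; first exact/measurable_EFinP.
rewrite (eq_integral (fun y => (w y)%:E))// => y _.
by rewrite /= ger0_norm.
Qed.

Let W : R := fine (\int[mu]_y (w y)%:E)%E.

Let WE : (\int[mu]_y (w y)%:E)%E = W%:E.
Proof. by rewrite fineK// ge0_fin_numE// integral_ge0// => y _; rewrite lee_fin. Qed.

Let u_le x : u x <= W * (1 + enorm x) `^ p.
Proof.
rewrite -lee_fin u_eq mulrC EFinM -WE -ge0_integralZl//; last 3 first.
- exact/measurable_EFinP.
- by move=> y _; rewrite lee_fin.
- by rewrite lee_fin powR_ge0.
apply: ge0_le_integral => //.
- by move=> y _; rewrite lee_fin mulr_ge0 ?powR_ge0.
- by apply/measurable_EFinP; apply: measurable_funM => //; exact: mdist.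
- by apply/measurable_EFinP; exact: measurable_funM.
move=> y _; rewrite lee_fin /w mulrA -/(f y) ler_pM2r// -powRM ?addr_ge0 ?enorm_ge0//.
by rewrite ge0_ler_powR ?nnegrE ?(ltW p0) ?mulr_ge0 ?addr_ge0 ?enorm_ge0// enorm_dist_le.
Qed.

Let W_gt0 : 0 < W.
Proof.
by have := lt_le_trans (u_gt0 0) (u_le 0); rewrite enorm0 addr0 powR1 mulr1.
Qed.

(** Two moving vectors cover both uses: (x - y) + t e gives continuity of u on lines, and e - s y
    near s = 0 gives the behaviour of u at infinity. *)
Let continuous_integral_line (K : R) (v1 w1 : 'rV[R]_n -> 'rV[R]_n) : 0 < K ->
  (forall s : R, measurable_fun setT (fun y => v1 y + s *: w1 y)) ->
  (forall y, enorm (v1 y) <= K * (1 + enorm y)) ->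
  (forall y, enorm (w1 y) <= K * (1 + enorm y)) ->
  continuous (fun s : R => \int[mu]_y (enorm (v1 y + s *: w1 y) `^ p * f y)).
Proof.
move=> K0 mvw v1K w1K s0.
(* For |s - s0| < 1 the vector has norm at most K (1 + |y|) (1 + |s|), and 1 + |s| <= 2 + |s0|. *)
pose M := K * (2 + `|s0|).
have M0 : 0 < M by rewrite mulr_gt0// ltr_wpDr.
have mh s : measurable_fun setT (fun y : 'rV[R]_n => enorm (v1 y + s *: w1 y) `^ p * f y).
  apply: measurable_funM => //; apply: (measurableT_comp (measurable_powR p)).
  exact: (measurableT_comp (@measurable_enorm R n) (mvw s)).
have bound s y : `]s0 - 1, s0 + 1[%classic s ->
    `|enorm (v1 y + s *: w1 y) `^ p * f y| <= M `^ p * w y.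
  rewrite /= in_itv/= => /andP[s1 s2].
  rewrite ger0_norm ?mulr_ge0 ?powR_ge0// /w mulrA ler_pM2r//.
  have y1 : 0 <= 1 + enorm y by rewrite addr_ge0 ?enorm_ge0.
  have My : 0 <= M * (1 + enorm y) by rewrite mulr_ge0 ?(ltW M0).
  rewrite -powRM ?(ltW M0)// ge0_ler_powR ?nnegrE ?enorm_ge0 ?(ltW p0)//.
  apply: le_trans (enormD _ _) _; rewrite enormZ.
  have sM : `|s| <= 1 + `|s0|.
    have -> : s = (s - s0) + s0 by rewrite subrK.
    by apply: le_trans (ler_normD _ _) _; rewrite lerD2r ler_norml; apply/andP; split; lra.
  have : `|s| * enorm (w1 y) <= (1 + `|s0|) * (K * (1 + enorm y)).
    by apply: ler_pM => //; exact: enorm_ge0.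
  by have := v1K y; rewrite /M; lra.
have intM : mu.-integrable setT (EFin \o (fun y => M `^ p * w y)).
  rewrite (_ : _ \o _ = (fun y => (M `^ p)%:E * (w y)%:E)%E); first exact: integrableZl.
  by apply/funext => y; rewrite /= EFinM.
apply: (@continuity_under_integral _ _ _ mu (fun s y => enorm (v1 y + s *: w1 y) `^ p * f y)
  setT measurableT (s0 - 1) (s0 + 1) _ _ (fun y => M `^ p * w y)).
- move=> s sI; apply: le_integrable intM => //; first exact/measurable_EFinP.
  move=> y _; rewrite /= lee_fin; apply: le_trans (bound _ _ sI) _; exact: ler_norm.
- apply: aeW => y _ s _.
  have H := @continuous_powR_comp R (fun r => enorm (v1 y + r *: w1 y)) p p0
    (@continuous_enorm_line _ _ _ _) (fun r => enorm_ge0 _) s.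
  exact: (cvgM H (cvg_cst (f y))).
- exact: intM.
- by move=> s sI; apply: aeW => y _; exact: bound.
- by rewrite inE /= in_itv/=; apply/andP; split; lra.
Qed.

Let u_Rintegral x : u x = \int[mu]_y (enorm (x - y) `^ p * f y).
Proof. exact: (congr1 fine (u_eq x)). Qed.

Lemma solution_continuous_line x e : continuous (fun t : R => u (x + t *: e)).
Proof.
rewrite (_ : (fun t => _) =
    (fun t => \int[mu]_y (enorm ((x - y) + t *: e) `^ p * f y))); last first.
  apply/funext => t; rewrite u_Rintegral.
  by apply: eq_Rintegral => y _; rewrite addrAC.
apply: (@continuous_integral_line (1 + enorm x + enorm e)).
- by have := enorm_ge0 x; have := enorm_ge0 e; lra.
- move=> s; rewrite [X in measurable_fun _ X](_ : _ = (fun y => (-1) *: y + (x + s *: e))).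
    exact: measurable_rV_affine.
  by apply/funext => y; rewrite scaleN1r addrCA addrA.
- move=> y; apply: le_trans (enorm_dist_le _ _) _.
  by rewrite ler_wpM2r ?addr_ge0 ?enorm_ge0// lerDl enorm_ge0.
- move=> y; have : 0 <= (1 + enorm x) * (1 + enorm y).
    by rewrite mulr_ge0 ?addr_ge0 ?enorm_ge0.
  by have := mulr_ge0 (enorm_ge0 e) (enorm_ge0 y); lra.
Qed.

Let f_le_w y : f y <= w y.
Proof.
by rewrite ler_peMl ?(ltW (f_gt0 y))// powR_ge1 ?(ltW p0)// lerDl enorm_ge0.
Qed.

(** The limit of |x|^-p u(x) as x goes to infinity along a ray. *)
Let beta : R := \int[mu]_y f y.

Let integral_f_lty : (\int[mu]_y (f y)%:E < +oo)%E.
Proof.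
apply: le_lt_trans integral_w_lty; apply: ge0_le_integral => //.
- by move=> y _; rewrite lee_fin ltW.
- exact/measurable_EFinP.
- exact/measurable_EFinP.
- by move=> y _; rewrite lee_fin.
Qed.

Let betaE : (\int[mu]_y (f y)%:E = beta%:E)%E.
Proof.
by rewrite fineK// ge0_fin_numE// integral_ge0// => y _; rewrite lee_fin ltW.
Qed.

Let beta_gt0 : 0 < beta.
Proof.
rewrite -lte_fin -betaE; apply: lt_le_trans (integral_exterior_gt0 ltr01 mf (fun z _ => f_gt0 z)) _.
apply: ge0_subset_integral => //; first exact/measurable_EFinP.
by move=> y _; rewrite lee_fin ltW.
Qed.

(** Integrate |x|^p <= 2^p (|x - y|^p + |y|^p) against [f]; the second term produces u 0. *)
Let growth x : beta * enorm x `^ p <= 2 `^ p * (u x + u 0).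
Proof.
have xE : (u x + u 0)%:E =
    (\int[mu]_y ((enorm (x - y) `^ p * f y)%:E + (enorm (0 - y) `^ p * f y)%:E))%E.
  rewrite ge0_integralD//; [by rewrite EFinD (u_eq x) (u_eq 0)| | | | ];
    by [move=> y _; rewrite lee_fin mulr_ge0 ?powR_ge0|
        apply/measurable_EFinP; apply: measurable_funM => //; exact: mdist].
rewrite -lee_fin EFinM -betaE [X in (_ <= X)%E]EFinM xE.
rewrite -ge0_integralZr//; last 3 first.
- exact/measurable_EFinP.
- by move=> y _; rewrite lee_fin ltW.
- by rewrite lee_fin powR_ge0.
rewrite -ge0_integralZl//; last 2 first.
- by apply: emeasurable_funD; apply/measurable_EFinP; apply: measurable_funM => //; exact: mdist.
- by move=> y _; rewrite adde_ge0// lee_fin mulr_ge0 ?powR_ge0.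
apply: ge0_le_integral => //.
- by move=> y _; rewrite lee_fin mulr_ge0 ?powR_ge0.
- by apply/measurable_EFinP; exact: measurable_funM.
- apply: emeasurable_funM => //; apply: emeasurable_funD;
    by apply/measurable_EFinP; apply: measurable_funM => //; exact: mdist.
move=> y _; rewrite lee_fin -mulrDl mulrA mulrC ler_pM2r//.
rewrite sub0r enormN; apply: le_trans (powRD_le p0 (enorm_ge0 _) (enorm_ge0 _)).
rewrite ge0_ler_powR ?nnegrE ?(ltW p0)// ?addr_ge0 ?enorm_ge0//.
by have := enormD (x - y) y; rewrite subrK.
Qed.

(** Far out [growth] forces u >= 1. For |x| < r only the [y] with |y| > r + 1 are kept; there |x -
    y| >= 1, and the mass of [f] on that exterior is a positive bound independent of [x]. *)
Let u_bounded_below : exists2 m : R, 0 < m & forall x, m <= u x.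
Proof.
(* The threshold beyond which [growth] yields u >= 1: if |x|^p >= A, then u 0 + 1 <= u x + u 0. *)
pose A := 2 `^ p * (u 0 + 1) / beta.
have A0 : 0 < A by rewrite divr_gt0// mulr_gt0 ?powR_gt0// addr_gt0.
pose r := A `^ p^-1.
have r0 : 0 < r by rewrite powR_gt0.
have r1 : 0 < r + 1 by rewrite addr_gt0.
pose c : R := \int[mu]_(y in E (r + 1)) f y.
have Ic : (\int[mu]_(y in E (r + 1)) (f y)%:E <= \int[mu]_y (f y)%:E)%E.
  apply: ge0_subset_integral => //; first exact/measurable_EFinP.
  by move=> y _; rewrite lee_fin ltW.
have cE : (\int[mu]_(y in E (r + 1)) (f y)%:E = c%:E)%E.
  rewrite fineK// ge0_fin_numE; first exact: le_lt_trans integral_f_lty.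
  by apply: integral_ge0 => y _; rewrite lee_fin ltW.
have c0 : 0 < c by rewrite -lte_fin -cE integral_exterior_gt0.
exists (Num.min 1 c) => [|x]; first by rewrite lt_min ltr01.
have [rx|xr] := leP r (enorm x); rewrite ge_min; apply/orP; [left|right].
  have Ax : A <= enorm x `^ p.
    have : r `^ p <= enorm x `^ p by rewrite ge0_ler_powR ?nnegrE ?enorm_ge0 ?(ltW p0) ?(ltW r0).
    by rewrite /r -powRrM mulVf ?gt_eqF// powRr1// ltW.
  have : 2 `^ p * (u 0 + 1) <= 2 `^ p * (u x + u 0).
    apply: le_trans (growth x); rewrite -ler_pdivrMl//; move: Ax; rewrite /A.
    by rewrite mulrC.
  by rewrite ler_pM2l ?powR_gt0//; lra.
rewrite -lee_fin -cE (u_eq x).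
apply: (@le_trans _ _ (\int[mu]_(y in E (r + 1)) (enorm (x - y) `^ p * f y)%:E)%E).
  apply: ge0_le_integral => //.
  - by move=> y _; rewrite lee_fin ltW.
  - by apply: measurable_funTS; exact/measurable_EFinP.
  - by apply: measurable_funTS; apply/measurable_EFinP; apply: measurable_funM => //; exact: mdist.
  move=> y ry; rewrite lee_fin ler_peMl ?(ltW (f_gt0 _))// powR_ge1 ?(ltW p0)//.
  have ry' : r + 1 < enorm y := ry.
  by have := enormB x (x - y); rewrite subKr; lra.
apply: ge0_subset_integral => //.
- by apply/measurable_EFinP; apply: measurable_funM => //; exact: mdist.
- by move=> y _; rewrite lee_fin mulr_ge0 ?powR_ge0.
Qed.

(** Scaling gives t^-p u(t e) as the integral of |e - y/t|^p f(y), a function of 1/t that is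
    continuous at 0, where it equals [beta]. *)
Let limit_at_infinity e : enorm e = 1 ->
  (fun k : nat => k.+1%:R^-1 `^ p * u (k.+1%:R *: e)) @ \oo --> beta.
Proof.
move=> e1; pose Phi (s : R) : R := \int[mu]_y (enorm (e + s *: (- y)) `^ p * f y).
have cPhi : continuous Phi.
  apply: (@continuous_integral_line 1 (fun _ => e) (fun y => - y)) => //.
  - move=> s; rewrite [X in measurable_fun _ X](_ : _ = (fun y => (-1) *: (s *: y + 0) + e)).
      by apply: (measurableT_comp (measurable_rV_affine _ _)); exact: measurable_rV_affine.
    by apply/funext => y; rewrite addr0 scaleN1r scalerN addrC.
  - by move=> y; rewrite e1 mul1r lerDl enorm_ge0.
  - by move=> y; rewrite enormN mul1r lerDr.
have Phi0 : Phi 0 = beta.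
  by apply: eq_Rintegral => y _; rewrite scale0r addr0 e1 powR1 mul1r.
have PhiE (t : R) : 0 < t -> Phi t^-1 = t^-1 `^ p * u (t *: e).
  move=> t0; have tV : 0 <= t^-1 by rewrite invr_ge0 ltW.
  have H : (\int[mu]_y (enorm (e + t^-1 *: (- y)) `^ p * f y)%:E =
      (t^-1 `^ p)%:E * (u (t *: e))%:E)%E.
    rewrite (u_eq (t *: e)) -ge0_integralZl//; last 3 first.
    - by apply/measurable_EFinP; apply: measurable_funM => //; exact: mdist.
    - by move=> y _; rewrite lee_fin mulr_ge0 ?powR_ge0.
    - by rewrite lee_fin powR_ge0.
    apply: eq_integral => y _.
    have -> : e + t^-1 *: (- y) = t^-1 *: (t *: e - y).
      by rewrite scalerBr scalerA mulVf ?gt_eqF// scale1r scalerN.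
    by rewrite enormZ (ger0_norm tV) powRM ?enorm_ge0// -EFinM mulrA.
  exact: (congr1 fine H).
rewrite -Phi0 (_ : (fun k => _) = Phi \o (@harmonic R)); last first.
  by apply/funext => k; rewrite /= PhiE ?ltr0Sn.
apply: continuous_cvg; [exact: cPhi|exact: cvg_harmonic].
Qed.

(** The order u <= u_l gives g <= u_l^-q <= f, so u_l - u is the integral of the nonnegative D = (b
    - a)(f - g). If it vanishes at one point, then D = 0 almost everywhere. For tau > 0 this is
    impossible, as g < f; for tau = 0 it gives f = g almost everywhere because b > a, and then the
    integral vanishes at every other point too. *)
Let dichotomy l : 0 < l -> (forall z, l < enorm z -> u z <= ul l z) ->
  (forall z, l < enorm z -> u z < ul l z) \/
  (tau = 0 /\ forall z, l < enorm z -> ul l z = u z).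
Proof.
move=> l0 uul.
have ul_f z : l < enorm z -> ul l z `^ (- q) <= f z.
  by move=> lz; rewrite ler_powRN ?(ltW q0)// uul.
have gf z : l < enorm z -> g l z <= f z.
  by move=> lz; apply: le_trans (g_le l0 lz) (ul_f z lz).
pose D x z := (b l x z - a x z) * (f z - g l z).
have D0 x z : l < enorm x -> l < enorm z -> 0 <= D x z.
  by move=> lx lz; rewrite mulr_ge0 ?subr_ge0 ?gf// ltW// a_lt_b.
have mD x : measurable_fun setT (D x).
  apply: measurable_funM; apply: measurable_funB => //; exact: mdist.
have key x : l < enorm x -> (\int[mu]_(z in E l) (D x z)%:E = (ul l x - u x)%:E)%E.
  move=> lx; have : ((ul l x)%:E = (u x)%:E + \int[mu]_(z in E l) (D x z)%:E)%E.
    rewrite (fold_ul l0 lx) (fold_u l0 lx) -ge0_integralD//; last 4 first.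
    - by move=> z lz; rewrite lee_fin addr_ge0// mulr_ge0// ltW// g_gt0.
    - apply: measurable_funTS; apply/measurable_EFinP.
      by apply: measurable_funD; apply: measurable_funM => //; exact: mdist.
    - by move=> z lz; rewrite lee_fin D0.
    - by apply: measurable_funTS; exact/measurable_EFinP.
    by apply: eq_integral => z _; rewrite -EFinD; congr EFin; rewrite /D; ring.
  case: (\int[mu]_(z in E l) _)%E => [r||]//; rewrite -EFinD => -[->].
  by rewrite addrAC subrr add0r.
have [strict|] := pselect (forall z, l < enorm z -> u z < ul l z); first by left.
move=> /existsNP[x0 /not_implyP[lx0 /negP]]; rewrite -leNgt => ulu0; right.
have I0 : (\int[mu]_(z in E l) (D x0 z)%:E = 0)%E.
  by rewrite key//; congr EFin; have := uul x0 lx0; lra.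
have tau_eq0 : tau = 0.
  apply/eqP/negPn/negP => tauN0.
  have tau_gt0 : 0 < tau by rewrite lt_neqAle eq_sym tauN0.
  suff : forall z, l < enorm z -> 0 < D x0 z.
    by move=> /(integral_exterior_gt0 l0 (mD x0)); rewrite I0 ltxx.
  move=> z lz.
  rewrite mulr_gt0 ?subr_gt0 ?a_lt_b//; apply: lt_le_trans (ul_f z lz).
  have z0 : 0 < enorm z by exact: lt_trans lz.
  rewrite gE// gtr_pMl ?powR_gt0 ?ul_gt0//.
  have := @gt0_ltr_powR R _ tau_gt0 (l / enorm z) 1.
  rewrite powR1 !nnegrE divr_ge0 ?(ltW l0) ?(ltW z0)//; apply => //.
  by rewrite ltr_pdivrMr// mul1r.
split => // x lx.
have mDE y : measurable_fun (E l) (fun z => (D y z)%:E).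
  by apply: measurable_funTS; exact/measurable_EFinP.
have absD y : l < enorm y ->
    (\int[mu]_(z in E l) `|(D y z)%:E| = \int[mu]_(z in E l) (D y z)%:E)%E.
  move=> ly; apply: eq_integral => z; rewrite inE => lz.
  by rewrite /= ger0_norm// D0.
have ae0 : ae_eq mu (E l) (fun z => (D x0 z)%:E) (cst 0%E).
  by apply/ae_eq_integral_abs => //; rewrite absD.
have : (\int[mu]_(z in E l) (D x z)%:E = 0)%E.
  rewrite -(absD x lx); apply/(ae_eq_integral_abs mu (mE l) (mDE x)).
  apply: filterS ae0 => z H lz; have := H lz => -[] /eqP.
  rewrite /D mulf_eq0 subr_eq0 gt_eqF ?a_lt_b//= => /eqP ->.
  by rewrite mulr0.
by rewrite key// => -[]; lra.
Qed.

(** * Narrow region principle *)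

Let bad l : set 'rV[R]_n := [set z | ul l z < u z].

Let mbad l : measurable (bad l).
Proof.
have -> : bad l = (fun z => u z - ul l z) @^-1` `]0, +oo[%classic.
  by apply/seteqP; split => z; rewrite /bad /= in_itv/= andbT subr_gt0.
rewrite -[X in measurable X]setTI.
have mB : measurable_fun setT (fun z => u z - ul l z).
  by apply: measurable_funB => //; exact: measurable_kelvin_transform.
exact: mB.
Qed.

(** Collects the growth in [z] of [b], namely (|z|/l)^p, of u_l^(-q-1), namely (|z|/l)^(-p(q+1)),
    and the normalisation |z|^p of u - u_l. *)
Let kern l z := enorm z `^ p * (l / enorm z) `^ (p * q).

Let kern_ge0 l z : 0 <= kern l z. Proof. by rewrite mulr_ge0 ?powR_ge0. Qed.

Let mkern l : measurable_fun setT (kern l).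
Proof.
apply: measurable_funM.
  exact: (measurableT_comp (measurable_powR p) (@measurable_enorm R n)).
have mV : measurable_fun setT (fun z : 'rV[R]_n => l / enorm z).
  by apply: measurable_funM => //; exact: measurable_enormV.
exact: (measurableT_comp (measurable_powR (p * q)) mV).
Qed.

(** Only g - f > 0 can hurt, and the tangent inequality bounds it by q u_l^(-q-1) (u - u_l). The
    factor 2^p comes from |kelvin l x - z| <= l + |z| <= 2|z|, and m^(-q-1) from u_l >= m
    (|z|/l)^p. *)
Let bad_estimate l m S x z : 0 < l -> 0 < m -> (forall y, m <= u y) ->
  l < enorm x -> l < enorm z -> bad l z -> u z - ul l z <= S * enorm z `^ p ->
  a x z * f z + b l x z * g l z <=
  b l x z * f z + a x z * g l z +
  enorm x `^ p * S * (2 `^ p * q * m `^ (- q - 1)) * kern l z.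
Proof.
move=> l0 m0 mu_ lx lz bz uS.
have x0 : 0 < enorm x by exact: lt_trans lx.
have z0 : 0 < enorm z by exact: lt_trans lz.
have zl : 0 < enorm z / l by rewrite divr_gt0.
have uz : 0 <= u z - ul l z by rewrite subr_ge0 ltW.
have ulz := ul_gt0 l0 lz.
pose X := q * ul l z `^ (- q - 1) * (u z - ul l z).
have X0 : 0 <= X by rewrite !mulr_ge0 ?powR_ge0 ?(ltW q0).
have gfX : g l z - f z <= X.
  apply: le_trans (powRN_sub_le q0 ulz (ltW bz)).
  by rewrite lerD2r g_le.
have ab : 0 <= b l x z - a x z by rewrite subr_ge0 ltW// a_lt_b.
have step1 : (b l x z - a x z) * (g l z - f z) <= b l x z * X.
  apply: (@le_trans _ _ ((b l x z - a x z) * X)); first by rewrite ler_wpM2l.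
  by rewrite ler_wpM2r// gerBl.
suff step2 : b l x z * X <= enorm x `^ p * S * (2 `^ p * q * m `^ (- q - 1)) * kern l z.
  by move: step1 step2; lra.
have bB : b l x z <= enorm x `^ p * 2 `^ p * (enorm z / l) `^ p.
  rewrite -!powRM ?mulr_ge0 ?enorm_ge0 ?invr_ge0 ?(ltW l0)//.
  rewrite ge0_ler_powR ?nnegrE ?mulr_ge0 ?enorm_ge0 ?invr_ge0 ?(ltW l0) ?(ltW p0)//.
  rewrite [X in _ <= X](_ : _ = enorm x / l * (2 * enorm z)); last by ring.
  rewrite ler_pM2l ?divr_gt0//.
  have kx : enorm (kelvin l x) <= l.
    by rewrite enorm_kelvin ler_pdivrMr// expr2 ler_pM2l// ltW.
  by apply: le_trans (enormB _ _) _; lra.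
have S0 : 0 <= S by rewrite -(@pmulr_lge0 _ (enorm z `^ p)) ?powR_gt0// (le_trans uz).
have ulB : ul l z `^ (- q - 1) <= m `^ (- q - 1) * ((enorm z / l) `^ p) `^ (- q - 1).
  rewrite -powRM ?(ltW m0) ?powR_ge0// -opprD ler_powRN ?mulr_gt0 ?powR_gt0//.
    by rewrite addr_ge0 ?(ltW q0).
  by rewrite /kelvin_transform mulrC ler_pM2l ?powR_gt0.
apply: (@le_trans _ _ (enorm x `^ p * 2 `^ p * (enorm z / l) `^ p *
    (q * (m `^ (- q - 1) * ((enorm z / l) `^ p) `^ (- q - 1)) * (S * enorm z `^ p)))).
  apply: ler_pM => //; apply: ler_pM => //.
    by rewrite mulr_ge0 ?powR_ge0 ?(ltW q0).
  by rewrite ler_pM2l.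
have kE : (l / enorm z) `^ (p * q) = (enorm z / l) `^ p * ((enorm z / l) `^ p) `^ (- q - 1).
  rewrite -powRrM -powRD ?(gt_eqF zl) ?implybT// -[enorm z / l]invf_div.
  rewrite powRV ?divr_ge0 ?(ltW l0) ?(ltW z0)// -powRN; congr powR; ring.
by rewrite /kern kE le_eqVlt; apply/orP; left; apply/eqP; ring.
Qed.

(** Let S be the supremum of (u - u_l)/|z|^p over the bad set. Integrating [bad_estimate] over the
    bad set gives S <= S K r with K r < 1, where r is its weighted measure, so S cannot be positive.
    Dividing by |z|^p makes S finite. *)
Let narrow l m : 0 < l -> 0 < m -> (forall y, m <= u y) ->
  ((2 `^ p * q * m `^ (- q - 1))%:E * \int[mu]_(z in E l `&` bad l) (kern l z)%:E < 1)%E ->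
  forall z, l < enorm z -> u z <= ul l z.
Proof.
move=> l0 m0 mu_; set K := 2 `^ p * q * _; set J := (\int[mu]_(z in _) _)%E => KJ.
have K0 : 0 < K by rewrite !mulr_gt0 ?powR_gt0.
have J0 : (0 <= J)%E by apply: integral_ge0 => z _; rewrite lee_fin.
have [r JE r1] : exists2 r : R, J = r%:E & K * r < 1.
  move: KJ J0; case: J => [r||]//; first by exists r.
  by rewrite gt0_muley ?lte_fin.
move=> z1 lz1; rewrite leNgt; apply/negP => bz1.
pose ratio z := (u z - ul l z) / enorm z `^ p.
pose A := ratio @` (E l `&` bad l).
have Az1 : A (ratio z1) by exists z1.
have ubA : has_ubound A.
  (* Outside the sphere 1 + |z| <= ((1 + l)/l) |z|, so the upper bound on u becomes homogeneous in
     |z|. *)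
  exists (W * ((1 + l) / l) `^ p) => _ [z [lz bz] <-].
  have z0 : 0 < enorm z by exact: lt_trans lz.
  rewrite ler_pdivrMr ?powR_gt0// -mulrA -powRM ?(ltW z0) ?divr_ge0 ?addr_ge0 ?(ltW l0)//.
  have : u z <= W * ((1 + l) / l * enorm z) `^ p.
    apply: le_trans (u_le z) _; rewrite ler_pM2l//.
    have c0 : 0 <= (1 + l) / l by rewrite divr_ge0 ?addr_ge0 ?(ltW l0).
    rewrite ge0_ler_powR ?nnegrE ?(ltW p0) ?(mulr_ge0 c0) ?addr_ge0 ?(ltW z0)//.
    have lz' : l < enorm z := lz.
    by rewrite mulrAC ler_pdivlMr//; lra.
  by have := ul_gt0 l0 lz; lra.
pose S := sup A.
have S0 : 0 < S.
  apply: lt_le_trans (ub_le_sup ubA Az1).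
  by rewrite divr_gt0 ?powR_gt0 ?subr_gt0// (lt_trans l0).
have ratio_le z : l < enorm z -> bad l z -> u z - ul l z <= S * enorm z `^ p.
  move=> lz bz; rewrite -ler_pdivrMr ?powR_gt0 ?(lt_trans l0)//.
  by apply: (ub_le_sup ubA); exists z.
suff : S <= S * (K * r) by rewrite -subr_le0 -{1}[S]mulr1 -mulrBr pmulr_rle0//; lra.
apply: ge_sup; first by exists (ratio z1).
move=> _ [x [lx bx] <-].
have x0 : 0 < enorm x by exact: lt_trans lx.
rewrite ler_pdivrMr ?powR_gt0// lerBlDr -lee_fin.
rewrite [X in (_ <= X)%E](_ : _ = ((ul l x)%:E + (enorm x `^ p * S * K)%:E * J)%E); last first.
  by rewrite JE -EFinM -EFinD; congr EFin; ring.
have c0 : 0 <= enorm x `^ p * S * K by rewrite !mulr_ge0 ?powR_ge0 ?ltW.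
rewrite /J -ge0_integralZl//; last 3 first.
- by apply: measurableI.
- by apply: measurable_funTS; exact/measurable_EFinP.
- by move=> z _; rewrite lee_fin.
rewrite integral_mkcondr (fold_u l0 lx) (fold_ul l0 lx).
have mk : measurable_fun setT (fun z => (enorm x `^ p * S * K)%:E * (kern l z)%:E)%E.
  by apply: emeasurable_funM => //; exact/measurable_EFinP.
have mka : measurable_fun (E l) ((fun z => (enorm x `^ p * S * K)%:E * (kern l z)%:E) \_ (bad l))%E.
  apply: measurable_funTS; apply: (measurable_restrictT _ (mbad l)).1.
  exact: measurable_funTS.
rewrite -ge0_integralD//; last 3 first.
- by move=> z lz; rewrite lee_fin addr_ge0// mulr_ge0// ltW// g_gt0.
- apply: measurable_funTS; apply/measurable_EFinP.
  by apply: measurable_funD; apply: measurable_funM => //; exact: mdist.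
- by move=> z _; apply: erestrict_ge0 => y _; rewrite -EFinM lee_fin mulr_ge0.
apply: ge0_le_integral => //.
- by move=> z lz; rewrite lee_fin addr_ge0// mulr_ge0// ltW// g_gt0.
- apply: measurable_funTS; apply/measurable_EFinP.
  by apply: measurable_funD; apply: measurable_funM => //; exact: mdist.
- apply: emeasurable_funD => //; apply: measurable_funTS; apply/measurable_EFinP.
  by apply: measurable_funD; apply: measurable_funM => //; exact: mdist.
move=> z lz; rewrite patchE; case: ifPn; rewrite ?inE.
  move=> bz; rewrite -EFinM -EFinD lee_fin.
  exact: bad_estimate (ratio_le z lz bz).
rewrite notin_setE /bad /= => /negP; rewrite -leNgt => uz.
rewrite adde0 lee_fin -subr_ge0.
have gf : g l z <= f z.
  by apply: le_trans (g_le l0 lz) _; rewrite ler_powRN ?(ltW q0).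
have : 0 <= (b l x z - a x z) * (f z - g l z).
  by rewrite mulr_ge0 ?subr_ge0// ltW// a_lt_b.
lra.
Qed.

(** The upper bound u <= W (1 + |z|)^p is a lower bound f >= W^-q (1 + |z|)^(-pq). Hence the decay
    of [kern] is dominated by the integrable [w], uniformly for l <= L. *)
Let kern_le L l z : 0 < l -> l <= L -> l < enorm z ->
  kern l z <= (1 + L) `^ (p * q) * W `^ q * w z.
Proof.
move=> l0 lL lz; have z0 : 0 < enorm z by exact: lt_trans lz.
have z1 : 0 < 1 + enorm z by rewrite addr_gt0.
have L1 : 0 < 1 + L by rewrite addr_gt0// (lt_le_trans l0).
have fW : W `^ (- q) * (1 + enorm z) `^ (- (p * q)) <= f z.
  rewrite -mulrN powRrM -powRM ?(ltW W_gt0) ?powR_ge0//.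
  by rewrite ler_powRN ?(ltW q0) ?u_gt0 ?u_le.
have h1 : (l / enorm z) `^ (p * q) <= (1 + L) `^ (p * q) * (1 + enorm z) `^ (- (p * q)).
  rewrite powRN -powRV ?(ltW z1)// -powRM ?invr_ge0 ?(ltW z1) ?(ltW L1)//.
  rewrite ge0_ler_powR ?nnegrE ?divr_ge0 ?mulr_ge0 ?(ltW l0) ?(ltW z0) ?(ltW z1) ?(ltW L1) ?(ltW p0) ?(ltW q0)//.
  rewrite ler_pdivrMr// mulrAC ler_pdivlMr// mulrDr mulr1 mulrDl mul1r.
  by rewrite lerD ?(ltW lz)// ler_pM2r.
have h2 : (1 + L) `^ (p * q) * (1 + enorm z) `^ (- (p * q)) <=
    (1 + L) `^ (p * q) * (W `^ q * f z).
  by rewrite ler_pM2l ?powR_gt0// -ler_pdivrMl ?powR_gt0 ?W_gt0// -powRN.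
rewrite /kern /w [X in _ <= X](_ : _ = (1 + enorm z) `^ p *
  ((1 + L) `^ (p * q) * (W `^ q * f z))); last by rewrite mulrCA -!mulrA.
apply: ler_pM; rewrite ?powR_ge0//; last exact: le_trans h2.
by rewrite ge0_ler_powR ?nnegrE ?(ltW p0) ?(ltW z0) ?(ltW z1)// lerDr.
Qed.

(** When every point eventually leaves the bad sets, their weighted measure tends to 0 by dominated
    convergence, and [narrow] then empties one of them. This serves both to start with small radii
    and to go past the supremum. *)
Let vanishing_bad_set (L : R) (lk : nat -> R) : (forall k, 0 < lk k <= L) ->
  (forall z, \forall k \near \oo, lk k < enorm z -> u z <= ul (lk k) z) ->
  exists k, forall z, lk k < enorm z -> u z <= ul (lk k) z.
Proof.
move=> lkL van; have [m m0 mu_] := u_bounded_below.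
pose K := 2 `^ p * q * m `^ (- q - 1).
have K0 : 0 < K by rewrite !mulr_gt0 ?powR_gt0.
pose h k : 'rV[R]_n -> \bar R := (fun z => (kern (lk k) z)%:E) \_ (E (lk k) `&` bad (lk k)).
have hE k : (\int[mu]_(z in E (lk k) `&` bad (lk k)) (kern (lk k) z)%:E = \int[mu]_z h k z)%E.
  by rewrite integral_mkcond.
have mh k : measurable_fun setT (h k).
  apply: (measurable_restrictT _ (measurableI _ _ (mE (lk k)) (mbad (lk k)))).1.
  by apply: measurable_funTS; exact/measurable_EFinP.
have h_cvg z : h ^~ z @ \oo --> 0%E.
  apply: cvg_near_cst; have := van z; apply: filterS => k Hk.
  rewrite /h patchE; case: ifPn => //; rewrite inE => -[lz bz].
  by have := le_lt_trans (Hk lz) bz; rewrite ltxx.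
pose C := (1 + L) `^ (p * q) * W `^ q.
have intC : mu.-integrable setT (fun z => C%:E * (w z)%:E)%E by exact: integrableZl.
have h_le z k : (`|h k z| <= C%:E * (w z)%:E)%E.
  have [l0 lL] := andP (lkL k).
  rewrite /h patchE; case: ifPn => [|_]; last first.
    by rewrite abse0 -EFinM lee_fin !mulr_ge0 ?powR_ge0.
  rewrite inE => -[lz _]; rewrite gee0_abs ?lee_fin//.
  exact: kern_le.
have [_ _] := dominated_convergence measurableT mh (measurable_cst 0%E)
  (aeW mu (fun z _ => h_cvg z)) intC (aeW mu (fun z k _ => h_le z k)).
rewrite integral0 => /fine_cvgP[hfin hcvg].
have KV : 0 < K^-1 by rewrite invr_gt0.
have [k [kfin klt]] : exists k, (\int[mu]_z h k z)%E \is a fin_num /\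
    fine (\int[mu]_z h k z)%E < K^-1.
  have [k _ H] := filterI hfin (cvgr_lt _ hcvg _ KV).
  by exists k; have := H k (leqnn k).
exists k; have [l0 _] := andP (lkL k); apply: (narrow l0 m0 mu_).
rewrite hE -(fineK kfin) -EFinM lte_fin -/K.
by rewrite -ltr_pdivlMl// mulr1.
Qed.

(** * Dependence on the radius and the critical sphere *)

Let ul_lim_infinity l e : 0 < l -> enorm e = 1 ->
  (fun k : nat => k.+1%:R^-1 `^ p * ul l (k.+1%:R *: e)) @ \oo --> (l `^ p)^-1 * u 0.
Proof.
move=> l0 e1.
have H : u (0 + (l ^+ 2 * k.+1%:R^-1) *: e) @[k --> \oo] --> u 0.
  have cu := @solution_continuous_line 0 e 0; rewrite /continuous_at scale0r addr0 in cu.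
  have c0 : (fun k : nat => l ^+ 2 * k.+1%:R^-1) @ \oo --> (0 : R).
    rewrite -[X in _ --> X](mulr0 (l ^+ 2)); apply: cvgM; first exact: cvg_cst.
    exact: cvg_harmonic.
  exact: (cvg_comp _ _ c0 cu).
rewrite (_ : (fun k => _) = (fun k => (l `^ p)^-1 * u (0 + (l ^+ 2 * k.+1%:R^-1) *: e))).
  by apply: cvgM => //; exact: cvg_cst.
apply/funext => k; have k0 : 0 < k.+1%:R :> R by rewrite ltr0Sn.
rewrite /kelvin_transform mulrA; congr (_ * u _).
  rewrite enormZ e1 mulr1 ger0_norm ?(ltW k0)// -powRM ?invr_ge0 ?divr_ge0 ?(ltW k0) ?(ltW l0)//.
  by rewrite mulrA mulVf ?gt_eqF// mul1r powRV ?ltW.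
rewrite add0r /kelvin scalerA enormZ e1 mulr1 ger0_norm ?(ltW k0)//; congr (_ *: _).
by field; rewrite gt_eqF.
Qed.

Let ul_continuous_radius l z : 0 < l -> z != 0 ->
  forall e : R, 0 < e -> \forall r \near l, `|ul l z - ul r z| < e.
Proof.
move=> l0 z0 e e0; have ez : 0 < enorm z by rewrite enorm_gt0.
(* The absolute value makes the base of the power nonnegative for every r, as [continuous_powR_comp]
   requires. The inverted point stays on the line through 0 and z, so continuity of u on lines is
   enough. *)
pose k (r : R) := enorm z `^ p * (`|r| `^ p)^-1 * u (0 + (r ^+ 2 * (enorm z ^+ 2)^-1) *: z).
have kE r : 0 < r -> ul r z = k r.
  move=> r0; rewrite /k /kelvin_transform /kelvin add0r powRM ?invr_ge0 ?(ltW r0) ?(ltW ez)//.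
  by rewrite powRV ?(ltW r0)// gtr0_norm.
have ck : k r @[r --> l] --> k l.
  have cn : continuous (fun r : R => `|r|) by move=> r; exact: norm_continuous.
  have cp : (fun r : R => `|r| `^ p) @ l --> `|l| `^ p.
    exact: (@continuous_powR_comp R (fun r : R => `|r|) p p0 cn (fun r => normr_ge0 r) l).
  have lp : `|l| `^ p != 0 by rewrite gt_eqF// powR_gt0// normr_gt0 gt_eqF.
  apply: cvgM; first by apply: cvgM; [exact: cvg_cst|exact: (cvgV lp cp)].
  have cu := @solution_continuous_line 0 z (l ^+ 2 * (enorm z ^+ 2)^-1).
  have c0 : (fun r : R => r ^+ 2 * (enorm z ^+ 2)^-1) @ l --> l ^+ 2 * (enorm z ^+ 2)^-1.
    by apply: cvgM; [exact: exprn_continuous|exact: cvg_cst].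
  exact: (cvg_comp _ _ c0 cu).
have /cvgrPdist_lt/(_ e e0) := ck.
have := nbhsx_ballx l _ l0; apply: filterS2 => r.
rewrite /ball /= => /(le_lt_trans (ler_norm _)) lr.
by rewrite !kE//; lra.
Qed.

(** Divide u <= u_l by |z|^p and go to infinity along a ray: the left side tends to [beta], the
    right side to l^-p u(0), since the inverted point tends to the centre. *)
Let radius_bounded l : 0 < l -> (forall z, l < enorm z -> u z <= ul l z) ->
  l `^ p * beta <= u 0.
Proof.
move=> l0 H; have [e e1] := @exists_enorm 1 ler01.
suff : beta <= (l `^ p)^-1 * u 0 by rewrite ler_pdivlMl ?powR_gt0.
apply: (ler_cvg_to (limit_at_infinity e1) (ul_lim_infinity l0 e1)).
have := @nbhs_infty_ger R l; apply: filterS => k lk.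
rewrite ler_pM2l ?powR_gt0 ?invr_gt0 ?ltr0Sn//; apply: H.
by rewrite enormZ e1 mulr1 ger0_norm// (le_lt_trans lk)// ltr_nat.
Qed.

(* The supremum of the radii l with u <= ul on the exterior of the sphere is
   critical: strict inequality there would survive for slightly larger radii. *)
Let exists_critical_sphere : exists2 l, 0 < l &
  tau = 0 /\ forall z, l < enorm z -> ul l z = u z.
Proof.
pose G := [set l | 0 < l /\ forall z, l < enorm z -> u z <= ul l z].
have [m m0 mu_] := u_bounded_below.
have [l1 Gl1] : exists l, G l.
  have [||k Hk] := @vanishing_bad_set 1 (fun k => k.+1%:R^-1).
  - by move=> k; rewrite invr_gt0 ltr0Sn/= invf_le1 ?ltr0Sn// ler1n.
  - move=> z; have [->|z0] := eqVneq z 0.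
      by apply: nearW => k; rewrite enorm0 ltNge invr_ge0 ler0n.
    have ez : 0 < enorm z by rewrite enorm_gt0.
    (* As u >= m, one has u_l z >= (|z|/l)^p m, and this exceeds u z once 1/l passes the threshold
       given here. *)
    have := @nbhs_infty_ger R ((u z / m) `^ p^-1 / enorm z); apply: filterS => k Hk _.
    rewrite /kelvin_transform invrK.
    have h1 : (u z / m) `^ p^-1 <= enorm z * k.+1%:R.
      by rewrite -ler_pdivrMl// mulrC; apply: (le_trans Hk); rewrite ler_nat.
    have h2 : u z / m <= (enorm z * k.+1%:R) `^ p.
      have : ((u z / m) `^ p^-1) `^ p <= (enorm z * k.+1%:R) `^ p.
        by rewrite ge0_ler_powR ?nnegrE ?powR_ge0 ?(ltW p0)// mulr_ge0 ?(ltW ez).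
      by rewrite -powRrM mulVf ?gt_eqF// powRr1// divr_ge0// ltW.
    rewrite ler_pdivrMr// in h2; apply: le_trans h2 _.
    by rewrite ler_wpM2l ?powR_ge0.
  by exists k.+1%:R^-1; split => //; rewrite invr_gt0 ltr0Sn.
have supG : has_sup G.
  split; first by exists l1.
  exists ((u 0 / beta) `^ p^-1) => l [l0 Hl].
  have := radius_bounded l0 Hl; rewrite -ler_pdivlMr// => H.
  have : (l `^ p) `^ p^-1 <= (u 0 / beta) `^ p^-1.
    by rewrite ge0_ler_powR ?nnegrE ?powR_ge0 ?invr_ge0 ?divr_ge0 ?(ltW p0) ?(ltW beta_gt0)// ltW.
  by rewrite -powRrM mulfV ?gt_eqF// powRr1// ltW.
pose l := sup G.
have l0 : 0 < l by apply: lt_le_trans Gl1.1 (ub_le_sup supG.2 Gl1).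
(* The supremum is itself admissible: by continuity in the radius, a violation at z would persist
   for admissible radii just below it. *)
have Gl : forall z, l < enorm z -> u z <= ul l z.
  move=> z lz; rewrite leNgt; apply/negP => bz.
  have z0 : z != 0 by rewrite -enorm_gt0 (lt_trans l0).
  have uz : 0 < u z - ul l z by rewrite subr_gt0.
  have [e /= e0 He] := ul_continuous_radius l0 z0 uz.
  have [r [r0 Hr] lr] := sup_adherent e0 supG.
  have rl : r <= l by apply: (ub_le_sup supG.2).
  rewrite -/l in lr.
  have := He r; rewrite /ball_ /= ger0_norm ?subr_ge0// -/l => /(_ ltac:(lra)).
  rewrite distrC => /(le_lt_trans (ler_norm _)).
  by have := Hr z (le_lt_trans rl lz); lra.
exists l => //; case: (dichotomy l0 Gl) => // strict; exfalso.
have [||k Hk] := @vanishing_bad_set (l + 1) (fun k => l + k.+1%:R^-1).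
- move=> k; rewrite addr_gt0 ?invr_gt0 ?ltr0Sn//= lerD2l invf_le1 ?ltr0Sn// ler1n.
  by [].
- move=> z; have [zl|lz] := leP (enorm z) l.
    apply: nearW => k; have : 0 < k.+1%:R^-1 :> R by rewrite invr_gt0 ltr0Sn.
    by move=> k0 /lt_le_trans/(_ zl); rewrite gtrDl ltNge (ltW k0).
  have z0 : z != 0 by rewrite -enorm_gt0 (lt_trans l0).
  have uz : 0 < ul l z - u z by rewrite subr_gt0 strict.
  have [e /= e0 He] := ul_continuous_radius l0 z0 uz.
  have := near_infty_natSinv_lt (PosNum e0); apply: filterS => k ke _.
  have := He (l + k.+1%:R^-1); rewrite /ball_ /= opprD addrA subrr sub0r normrN.
  rewrite ger0_norm ?invr_ge0// => /(_ ke) /(le_lt_trans (ler_norm _)); lra.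
have : G (l + k.+1%:R^-1) by split => //; rewrite addr_gt0 ?invr_gt0 ?ltr0Sn.
move=> /(ub_le_sup supG.2); rewrite -/l gerDl leNgt invr_gt0.
by rewrite ltr0Sn.
Qed.

Lemma solution_mass_gt0 : 0 < \int[mu]_y u y `^ (- q).
Proof. exact: beta_gt0. Qed.

(** Equality on the exterior makes the two limits at infinity agree, which computes l. It extends to
    the ball because the Kelvin transform is an involution, and to the sphere because inversion
    fixes it. *)
Lemma solution_kelvin_invariant : tau = 0 /\ exists l, [/\ 0 < l,
  l `^ p * \int[mu]_y u y `^ (- q) = u 0 &
  forall z, z != 0 -> u z = (enorm z / l) `^ p * u (kelvin l z)].
Proof.
have [l l0 [tau_eq0 H]] := exists_critical_sphere.
split => //; exists l; split => //.
  have [e e1] := @exists_enorm 1 ler01.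
  suff : beta = (l `^ p)^-1 * u 0 by move=> betaE'; rewrite -[LHS]/(l `^ p * beta) betaE' mulVKf// gt_eqF// powR_gt0.
  apply/eqP; rewrite eq_le; apply/andP; split.
    apply: (ler_cvg_to (limit_at_infinity e1) (ul_lim_infinity l0 e1)).
    have := @nbhs_infty_ger R l; apply: filterS => k lk.
    by rewrite H// enormZ e1 mulr1 ger0_norm// (le_lt_trans lk)// ltr_nat.
  apply: (ler_cvg_to (ul_lim_infinity l0 e1) (limit_at_infinity e1)).
  have := @nbhs_infty_ger R l; apply: filterS => k lk.
  by rewrite H// enormZ e1 mulr1 ger0_norm// (le_lt_trans lk)// ltr_nat.
move=> z z0; have ez : 0 < enorm z by rewrite enorm_gt0.
have [lz|zl|lz] := ltgtP l (enorm z); first by rewrite -[LHS](H z lz).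
- have lk : l < enorm (kelvin l z) by rewrite enorm_kelvin ltr_pdivlMr// expr2 ltr_pM2l.
  rewrite -(H _ lk) /kelvin_transform kelvinK ?gt_eqF// enorm_kelvin mulrA.
  have lN0 : l != 0 by rewrite gt_eqF.
  have zN0 : enorm z != 0 by rewrite gt_eqF.
  rewrite -powRM ?divr_ge0 ?sqr_ge0 ?(ltW l0) ?(ltW ez)//.
  rewrite (_ : _ / l * _ = 1) ?powR1 ?mul1r//.
  by field; rewrite lN0.
rewrite -lz divff ?gt_eqF// powR1 mul1r /kelvin -lz divff ?scale1r//.
by rewrite sqrf_eq0 gt_eqF.
Qed.

End moving_spheres.

(** * From invariance at every centre to the explicit formula *)

Section solution_classification.
Context {R : realType} {n : nat}.
Hypothesis n0 : (0 < n)%N.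
Local Notation mu := (lebesgue_rV_borel R n).
Variables p q : R.
Hypotheses (p0 : 0 < p) (q0 : 0 < q).
Hypothesis pq : q <= 1 + 2 * n%:R / p.
Variable u : 'rV[R]_n -> R.
Hypothesis u_gt0 : forall x, 0 < u x.
Hypothesis mu_u : measurable_fun setT u.
Hypothesis u_eq : forall x,
  (u x)%:E = (\int[mu]_y (enorm (x - y) `^ p * u y `^ (- q))%:E)%E.

Let tau_ge0 : 0 <= (2 * n)%:R + p - p * q.
Proof.
have : p * q <= p * (1 + 2 * n%:R / p) by rewrite ler_pM2l.
by rewrite mulrDr mulr1 mulrCA divff ?gt_eqF// mulr1 natrM; lra.
Qed.

Let beta := \int[mu]_y u y `^ (- q).

Let beta_gt0 : 0 < beta. Proof. exact: solution_mass_gt0 u_eq. Qed.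

Let ge0_integral_translate b (f : 'rV[R]_n -> \bar R) : measurable_fun setT f ->
  (forall x, (0 <= f x)%E) -> (\int[mu]_x f (x + b)%R = \int[mu]_x f x)%E.
Proof.
move=> mf f0; rewrite -[RHS](@ge0_integral_rV_affine _ _ 1 b)// expr1n mul1e.
by apply: eq_integral => x _; rewrite scale1r.
Qed.

Let mf : measurable_fun setT (fun y => u y `^ (- q)).
Proof. exact: (measurableT_comp (measurable_powR (- q)) mu_u). Qed.

(** Both the equation and the mass of u^-q are translation invariant, so the same [beta] relates the
    critical radius to u at every centre. *)
Let kelvin_invariant_at b : exists l, [/\ 0 < l, l `^ p * beta = u b &
  forall z, z != 0 -> u (z + b) = (enorm z / l) `^ p * u (kelvin l z + b)].
Proof.
pose ub y := u (y + b).
have mub : measurable_fun setT ub.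
  rewrite [X in measurable_fun _ X](_ : _ = u \o (fun y => 1 *: y + b)).
    by apply: measurableT_comp => //; exact: measurable_rV_affine.
  by apply/funext => y; rewrite /= scale1r.
have ub_eq x : (ub x)%:E = (\int[mu]_y (enorm (x - y) `^ p * ub y `^ (- q))%:E)%E.
  rewrite /ub (u_eq (x + b)) -(ge0_integral_translate b).
  - by apply: eq_integral => y _; rewrite opprD addrACA subrr addr0.
  - apply/measurable_EFinP; apply: measurable_funM => //.
    exact: (measurableT_comp (measurable_powR p) (measurable_dist _)).
  - by move=> y; rewrite lee_fin mulr_ge0 ?powR_ge0.
have [_ [l [l0 lb H]]] := solution_kelvin_invariant n0 p0 q0 tau_ge0
  (fun x => u_gt0 (x + b)) mub ub_eq.
exists l; split => //; move: lb; rewrite /ub add0r => <-; congr (_ * _).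
apply: (congr1 fine); rewrite -(ge0_integral_translate b)//; first exact/measurable_EFinP.
by move=> y; rewrite lee_fin powR_ge0.
Qed.

Lemma solution_critical_exponent : q = 1 + 2 * n%:R / p.
Proof.
have [tau0 _] := solution_kelvin_invariant n0 p0 q0 tau_ge0 u_gt0 mu_u u_eq.
apply: (mulfI (lt0r_neq0 p0)).
by rewrite mulrDr mulr1 mulrCA divff ?gt_eqF// mulr1; move: tau0; rewrite natrM; lra.
Qed.

Lemma solution_classification : exists (a d : R) (xbar : 'rV[R]_n),
  [/\ 0 < a, 0 < d & forall x, u x = ((d + enorm (x - xbar) ^+ 2) / a) `^ (p / 2)].
Proof.
have p2 : 0 < 2 / p by rewrite divr_gt0.
have pp : 2 / p * (p / 2) = 1 by field; rewrite gt_eqF.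
have pp' : p * (2 / p) = 2 by field; rewrite gt_eqF.
pose v x := (u x / beta) `^ (2 / p).
have v0 x : 0 < v x by rewrite powR_gt0// divr_gt0.
have cv x e : continuous (fun t : R => v (x + t *: e)).
  have cu : continuous (fun t : R => u (x + t *: e) / beta).
    move=> t; apply: cvgM; last exact: cvg_cst.
    exact: (solution_continuous_line n0 p0 u_gt0 mu_u u_eq).
  apply: (continuous_powR_comp p2 cu) => t.
  by rewrite divr_ge0 ?(ltW (u_gt0 _)) ?(ltW beta_gt0).
have vI x y : x != y -> v x * v y =
    enorm (y - x) ^+ 2 * v (x + (v x / enorm (y - x) ^+ 2) *: (y - x)).
  move=> xy; have [l [l0 lx H]] := kelvin_invariant_at x.
  have yx : y - x != 0 by rewrite subr_eq0 eq_sym.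
  have eyx : 0 < enorm (y - x) by rewrite enorm_gt0.
  have vx : v x = l ^+ 2.
    by rewrite /v -lx mulfK ?gt_eqF// -powRrM pp' powR_mulrn ?ltW.
  have := H _ yx; rewrite subrK /kelvin [_ *: _ + x]addrC -vx => uy.
  rewrite {2}/v uy -mulrA powRM ?powR_ge0 ?divr_ge0 ?(ltW (u_gt0 _)) ?(ltW beta_gt0)//.
  rewrite -powRrM pp' powR_mulrn ?divr_ge0 ?(ltW l0) ?(ltW eyx)// -/(v _) vx.
  by field; rewrite gt_eqF.
have [d [xbar [d0 vE]]] := conformal_factor_quadratic v0 cv vI.
(* From v = (u / beta)^(2/p) one gets u = (beta^(2/p) v)^(p/2), so 1/a = beta^(2/p). *)
exists (beta `^ (- (2 / p))), d, xbar; split => //; first by rewrite powR_gt0.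
move=> x; rewrite -vE powRN invrK.
rewrite -powRM ?divr_ge0 ?(ltW (u_gt0 _)) ?(ltW beta_gt0)// divfK ?gt_eqF//.
by rewrite -powRrM pp powRr1// ltW.
Qed.

End solution_classification.

(** * Finiteness, positivity and Borel measurability *)

Section lebesgue_rV.
Context {R : realType} {n : nat}.
Local Notation mu := (lebesgue_rV_borel R n).
Local Notation lam := (lebesgue_rV R n).

(** The identity from R^n with its Lebesgue sets to R^n with its Borel sets; naming it lets Borel
    functions and integrals be transferred as compositions and pushforwards. *)
Definition lebesgue_rV_id (y : lebesgue_rV_type R n) : 'rV[R]_n := y.

Lemma measurable_lebesgue_rV_id : measurable_fun setT lebesgue_rV_id.
Proof. by move=> _ A mA; rewrite setTI; apply: sub_caratheodory; exact: sub_sigma_algebra. Qed.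

Lemma measurable_lebesgue_rV d (T : measurableType d) (g : 'rV[R]_n -> T) :
  measurable_fun setT g -> measurable_fun [set: lebesgue_rV_type R n] g.
Proof. by move=> mg; exact: (measurableT_comp mg measurable_lebesgue_rV_id). Qed.

Lemma ge0_integral_lebesgue_rV (g : 'rV[R]_n -> \bar R) :
  measurable_fun setT g -> (forall y, (0 <= g y)%E) ->
  (\int[lam]_y g y = \int[mu]_y g y)%E.
Proof.
move=> mg g0.
transitivity (\int[pushforward lam lebesgue_rV_id]_y g y)%E.
  by rewrite (ge0_integral_pushforward measurable_lebesgue_rV_id).
apply: eq_measure_integral; first exact: measurable_lebesgue_rV_id.
by move=> mid A mA _; exact: lebesgue_rV_borelE.
Qed.

Lemma lebesgue_rV_set1 (x : 'rV[R]_n) : (0 < n)%N -> lam [set x] = 0%E.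
Proof.
move=> n0; rewrite lebesgue_rV_borelE; last exact: measurable_rV_set1.
exact: lebesgue_rV_borel_set1.
Qed.

Lemma lebesgue_rV_setT_gt0 : (0 < lam setT)%E.
Proof.
pose A (i : 'I_n) : set (measurableTypeR R) := `[0, 1]%classic.
have mA : measurable [set x : 'rV[R]_n | forall i, A i (x ord0 i)].
  rewrite (_ : [set x | _] = \bigcap_(i in [set: 'I_n]) (@rV_coord R n i @^-1` A i)).
    apply: fin_bigcap_measurable => // i _.
    by rewrite -[X in measurable X]setTI; apply: measurable_rV_coord => //; exact: measurable_itv.
  by apply/seteqP; split => [x Ax i _|x Ax i]; exact: Ax.
have : mu [set x | forall i, A i (x ord0 i)] = 1%E.
  rewrite lebesgue_rV_borel_box => [|i]; last exact: measurable_itv.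
  by apply: big1 => i _; rewrite /A lebesgue_measure_itv/= lte_fin ltr01 oppr0 adde0.
rewrite -lebesgue_rV_borelE// => A1.
apply: (@lt_le_trans _ _ 1%E); first exact: lte01.
by rewrite -A1; apply: le_measure; rewrite ?inE//; apply: sub_caratheodory; exact: sub_sigma_algebra.
Qed.

End lebesgue_rV.

Lemma measurable_poweRV (R : realType) d (T : measurableType d) (u : T -> \bar R) (q : R) :
  0 < q -> (forall x, (0 <= u x)%E) -> measurable_fun setT u ->
  measurable_fun setT (fun x => poweRV (u x) q).
Proof.
move=> q0 u0 mu_.
(* fine +oo = 0 and 0 `^ (- q) = 0, so the real summand vanishes unless 0 < u x < +oo *)
rewrite [X in measurable_fun _ X](_ : _ =
  (fun x => +oo * (\1_(u @^-1` [set 0]) x)%:E + (fine (u x) `^ (- q))%:E)%E).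
  apply: emeasurable_funD.
    apply: emeasurable_funM => //; apply/measurable_EFinP; apply: measurable_indic.
    by rewrite -[X in measurable X]setTI; apply: mu_ => //; exact: emeasurable_set1.
  apply/measurable_EFinP.
  apply: (measurableT_comp (measurable_powR (- q))).
  exact: (measurableT_comp (fine_measurable measurableT)).
apply/funext => x; rewrite indicE; have [ux|ux] := eqVneq (u x) 0%E.
  by rewrite mem_set// ux poweRV0// mule1 /= powR0 ?oppr_eq0 ?gt_eqF// adde0.
rewrite memNset ?mule0 ?add0e; last by apply/eqP.
move: (u0 x) ux; case: (u x) => [r||]//.
  rewrite lee_fin eqe => r0 rN0; rewrite poweRV_fin//.
  by rewrite lt_neqAle eq_sym rN0.
by move=> _ _; rewrite poweRVy//= powR0// oppr_eq0 gt_eqF.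
Qed.

(** * Reduction to a positive real-valued Borel solution *)

Section extended_solution.
Context {R : realType} {n : nat}.
Hypothesis n0 : (0 < n)%N.
Local Notation mu := (lebesgue_rV_borel R n).
Local Notation lam := (lebesgue_rV R n).
Variables p q : R.
Hypotheses (p0 : 0 < p) (q0 : 0 < q).
Variable u : 'rV[R]_n -> \bar R.
Hypothesis u_ge0 : forall x, (0 <= u x)%E.
Hypothesis u_meas : measurable_fun [set: lebesgue_rV_type R n] u.
Hypothesis u_eq : forall x : 'rV[R]_n,
  u x = (\int[lam]_y ((enorm (x - y) `^ p)%:E * poweRV (u y) q))%E.

Let f y := poweRV (u y) q.

Let f_ge0 y : (0 <= f y)%E.
Proof. by rewrite /f /poweRV inve_ge0 poweR_ge0. Qed.

Let mf : measurable_fun [set: lebesgue_rV_type R n] f.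
Proof. exact: measurable_poweRV. Qed.

Let mdist x : measurable_fun setT (fun y : 'rV[R]_n => (enorm (x - y) `^ p)%:E).
Proof.
apply/measurable_EFinP.
exact: (measurableT_comp (measurable_powR p) (measurable_dist x)).
Qed.

Let mk x : measurable_fun [set: lebesgue_rV_type R n]
  (fun y => ((enorm (x - y) `^ p)%:E * f y)%E).
Proof. exact: (emeasurable_funM (measurable_lebesgue_rV (mdist x)) mf). Qed.

Let k_ge0 x y : (0 <= (enorm (x - y) `^ p)%:E * f y)%E.
Proof. by rewrite mule_ge0// lee_fin powR_ge0. Qed.

Let measurable_set1 (x : lebesgue_rV_type R n) : measurable [set x].
Proof. by apply: sub_caratheodory; apply: sub_sigma_algebra; exact: measurable_rV_set1. Qed.

(** If u were infinite off a single point, the integrand would vanish almost everywhere since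
    infinity^-q = 0, and u would be 0 at another point where it is supposed infinite. *)
Let two_finite_values : exists x1 x2, [/\ x1 != x2, (u x1 < +oo)%E & (u x2 < +oo)%E].
Proof.
apply: contrapT => H.
have [x1 Hx1] : exists x1, forall x, x != x1 -> u x = +oo%E.
  have [[x1 ux1]|H0] := pselect (exists x, (u x < +oo)%E).
    exists x1 => x xx1; apply/eqP; rewrite -leye_eq leNgt; apply/negP => ux.
    by apply: H; exists x, x1.
  exists 0 => x _; apply/eqP; rewrite -leye_eq leNgt; apply/negP => ux.
  by apply: H0; exists x.
have [e e1] := @exists_enorm R n n0 1 ler01.
have xx1 : x1 + e != x1.
  by rewrite -subr_eq0 addrAC subrr add0r -enorm_gt0 e1.
suff : u (x1 + e) = 0%E by rewrite Hx1.
rewrite u_eq (ge0_negligible_integral (measurable_set1 x1))//; last exact: lebesgue_rV_set1.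
apply: integral0_eq => y [_ /= /eqP yx1].
by rewrite Hx1// poweRVy// mule0.
Qed.

Let w y := (((1 + enorm y) `^ p)%:E * f y)%E.

Let w_ge0 y : (0 <= w y)%E.
Proof. by rewrite mule_ge0// lee_fin powR_ge0. Qed.

Let mw : measurable_fun [set: lebesgue_rV_type R n] w.
Proof.
have m1 : measurable_fun setT (fun y : 'rV[R]_n => 1 + enorm y).
  by apply: measurable_funD => //; exact: measurable_enorm.
have m2 : measurable_fun setT (fun y : 'rV[R]_n => ((1 + enorm y) `^ p)%:E).
  by apply/measurable_EFinP; exact: (measurableT_comp (measurable_powR p) m1).
exact: (emeasurable_funM (measurable_lebesgue_rV m2) mf).
Qed.

Let integral_weight_lty : (\int[lam]_y w y < +oo)%E.
Proof.
have [x1 [x2 [x12 u1 u2]]] := two_finite_values.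
have [C C0 HC] := weight_le_dist p0 x12.
apply: (@le_lt_trans _ _ (C%:E * (u x1 + u x2))%E); last first.
  apply: lte_mul_pinfty; rewrite ?lee_fin ?(ltW C0)//.
  exact: lte_add_pinfty.
rewrite (u_eq x1) (u_eq x2) -(ge0_integralD lam measurableT (fun y _ => k_ge0 x1 y) (mk x1)
  (fun y _ => k_ge0 x2 y) (mk x2)).
have mD : measurable_fun [set: lebesgue_rV_type R n]
    (fun y => (enorm (x1 - y) `^ p)%:E * f y + (enorm (x2 - y) `^ p)%:E * f y)%E.
  exact: emeasurable_funD (mk x1) (mk x2).
rewrite -(ge0_integralZl lam measurableT mD); last 2 first.
- by move=> y _; rewrite adde_ge0// k_ge0.
- by rewrite lee_fin ltW.
have mC : measurable_fun [set: lebesgue_rV_type R n] (fun=> C%:E) by exact: measurable_cst.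
have le_w y : (w y <= C%:E * ((enorm (x1 - y) `^ p)%:E * f y + (enorm (x2 - y) `^ p)%:E * f y))%E.
  rewrite -ge0_muleDl ?lee_fin ?powR_ge0// muleA.
  by apply: lee_wpmul2r => //; rewrite -EFinD -EFinM lee_fin.
exact: (ge0_le_integral lam measurableT (fun y _ => w_ge0 y) mw (emeasurable_funM mC mD)
  (fun y _ => le_w y)).
Qed.

Let u_lty x : (u x < +oo)%E.
Proof.
have x0 : (0 <= ((1 + enorm x) `^ p)%:E)%E by rewrite lee_fin powR_ge0.
apply: (@le_lt_trans _ _ (((1 + enorm x) `^ p)%:E * \int[lam]_y w y)%E); last first.
  exact: lte_mul_pinfty.
rewrite u_eq -(ge0_integralZl lam measurableT mw (fun y _ => w_ge0 y) x0).
have mC : measurable_fun [set: lebesgue_rV_type R n] (fun=> ((1 + enorm x) `^ p)%:E).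
  exact: measurable_cst.
have le_k y : ((enorm (x - y) `^ p)%:E * f y <= ((1 + enorm x) `^ p)%:E * w y)%E.
  rewrite muleA; apply: lee_wpmul2r => //.
  rewrite -EFinM lee_fin -powRM ?addr_ge0 ?enorm_ge0//.
  by rewrite ge0_ler_powR ?nnegrE ?(ltW p0) ?mulr_ge0 ?addr_ge0 ?enorm_ge0// enorm_dist_le.
exact: (ge0_le_integral lam measurableT (fun y _ => k_ge0 x y) (mk x) (emeasurable_funM mC mw)
  (fun y _ => le_k y)).
Qed.

(** Finiteness of u is what makes this positive; a zero of u is not yet excluded, and there [f] is
    infinite. *)
Let f_gt0 y : (0 < f y)%E.
Proof.
rewrite /f; move: (u_ge0 y) (u_lty y); case: (u y) => [r||]//; rewrite lee_fin => r0 _.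
move: r0; rewrite le_eqVlt => /predU1P[<-|r0]; first by rewrite poweRV0.
by rewrite poweRV_fin// lte_fin powR_gt0.
Qed.

(** At a zero of u the integrand vanishes almost everywhere while [f] is positive, so almost every y
    equals x; a point being null, all of R^n would be null. *)
Let u_gt0 x : (0 < u x)%E.
Proof.
rewrite lt0e u_ge0 andbT; apply/eqP => ux0.
have : ae_eq lam setT (fun y => ((enorm (x - y) `^ p)%:E * f y)%E) (cst 0%E).
  apply/(ae_eq_integral_abs lam measurableT (mk x)).
  rewrite -[RHS]ux0 u_eq; apply: eq_integral => y _.
  by rewrite gee0_abs// k_ge0.
move=> aeH.
have n1 : lam.-negligible (~` [set y : lebesgue_rV_type R n | y = x]).
  apply: filterS aeH => y /(_ I)/eqP.
  rewrite mule_eq0 [f y == _]gt_eqF ?f_gt0// orbF eqe powR_eq0 => /andP[+ _].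
  by rewrite enorm_eq0 subr_eq0 => /eqP.
have n2 : lam.-negligible [set (x : lebesgue_rV_type R n)].
  by apply/negligibleP; [exact: measurable_set1|exact: lebesgue_rV_set1].
have neg : lam.-negligible [set: lebesgue_rV_type R n].
  by apply: negligibleS (negligibleU n1 n2) => y _; have [->|yx] := pselect (y = x); [right|left].
by have := @lebesgue_rV_setT_gt0 R n; rewrite (measure_negligible _ neg)// ltxx.
Qed.

Let v x : R := fine (u x).

Let vE x : u x = (v x)%:E.
Proof. by rewrite fineK// ge0_fin_numE. Qed.

Let v_gt0 x : 0 < v x. Proof. by rewrite -lte_fin -vE. Qed.

(** The function u is given only as Lebesgue measurable, but the equation exhibits it as a parameter
    integral whose kernel is Borel in [x]; Tonelli on the product of the Borel and Lebesgue
    structures makes it Borel. *)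
Let measurable_v : measurable_fun [set: 'rV[R]_n] v.
Proof.
have mF : measurable_fun [set: 'rV[R]_n]
    (fun x => \int[lam]_y ((enorm (x - y) `^ p)%:E * f y))%E.
  pose F (z : 'rV[R]_n * lebesgue_rV_type R n) :=
    ((enorm (z.1 - lebesgue_rV_id z.2) `^ p)%:E * f z.2)%E.
  have mF : measurable_fun setT F.
    apply: emeasurable_funM; last first.
      by apply: (measurableT_comp mf); exact: measurable_snd.
    apply/measurable_EFinP; apply: (measurableT_comp (measurable_powR p)).
    apply: (measurableT_comp (@measurable_enorm R n)).
    apply: measurable_fun_rVP => i.
    rewrite (_ : _ \o _ = (fun z : 'rV[R]_n * lebesgue_rV_type R n =>
      rV_coord i z.1 - rV_coord i (lebesgue_rV_id z.2))); last first.
      by apply/funext => z; rewrite /= /rV_coord !mxE.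
    apply: measurable_funB.
      by apply: (measurableT_comp (@measurable_rV_coord R n i)); exact: measurable_fst.
    apply: (measurableT_comp (@measurable_rV_coord R n i)).
    by apply: (measurableT_comp measurable_lebesgue_rV_id); exact: measurable_snd.
  have F0 z : (0 <= F z)%E by exact: k_ge0.
  exact: (measurable_fun_fubini_tonelli_F (m2 := lam) _ mF F0).
apply: (measurableT_comp (fine_measurable measurableT)).
rewrite [X in measurable_fun _ X](_ : _ =
  (fun x => \int[lam]_y ((enorm (x - y) `^ p)%:E * f y))%E)//.
by apply/funext => x; exact: u_eq.
Qed.

Lemma extended_solution_real : exists v : 'rV[R]_n -> R,
  [/\ forall x, u x = (v x)%:E, forall x, 0 < v x, measurable_fun setT v &
      forall x, (v x)%:E = (\int[mu]_y (enorm (x - y) `^ p * v y `^ (- q))%:E)%E].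
Proof.
exists v; split => // x; rewrite -vE u_eq -ge0_integral_lebesgue_rV.
- by apply: eq_integral => y _; rewrite vE poweRV_fin// EFinM.
- apply/measurable_EFinP; apply: measurable_funM.
    exact: (measurableT_comp (measurable_powR p) (measurable_dist x)).
  exact: (measurableT_comp (measurable_powR (- q)) measurable_v).
- by move=> y; rewrite lee_fin mulr_ge0 ?powR_ge0.
Qed.

End extended_solution.

Theorem theorem1p5 (R : realType) (n : nat) (p q : R)
    (u : 'rV[R]_n -> \bar R)
    (hn : (1 <= n)%N) (hp : 0 < p) (hq : 0 < q)
    (hq' : q <= 1 + 2 * n%:R / p)
    (u_ge0 : forall x, (0 <= u x)%E)
    (u_meas : measurable_fun [set: lebesgue_rV_type R n] u)
    (u_eq : forall x : 'rV[R]_n,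
       u x = (\int[lebesgue_rV R n]_y
                ((enorm (x - y) `^ p)%:E * poweRV (u y) q))%E) :
  q = 1 + 2 * n%:R / p /\
  exists (a d : R) (xbar : 'rV[R]_n),
    [/\ 0 < a, 0 < d &
        forall x : 'rV[R]_n,
          u x = (((d + enorm (x - xbar) ^+ 2) / a) `^ (p / 2))%:E].
Proof.
have [v [uE v0 mv v_eq]] := extended_solution_real hn hp hq u_ge0 u_meas u_eq.
split; first exact: (solution_critical_exponent hn hp hq hq' v0 mv v_eq).
have [a [d [xbar [a0 d0 vE]]]] := solution_classification hn hp hq hq' v0 mv v_eq.
by exists a, d, xbar; split => // x; rewrite uE vE.
Qed.
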